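(* Let $\gamma>0$ be such that $\sigma\left(A\otimes I+I\otimes A+\frac{1}{\gamma^2}\sum_{k=1}^m N_k\otimes N_k\right)\subset\mathbb C_-$. Let $x_{x_0}$ be the solution of $$\dot x_{x_0}(t)=Ax_{x_0}(t)+\sum_{k=1}^mN_kx_{x_0}(t)u_k(t),\quad x_{x_0}(0)=X_0v_0,$$ and let $(p_{0,i})_{i=1,\ldots,n}$ be an orthonormal basis of $\mathbb R^n$ of eigenvectors of the Gramian $P_0$. Then, for every $i$, $$\|\langle x_{x_0}(\cdot),p_{0,i}\rangle_2\|_{L^2}\le\lambda_{0,i}^{\frac12}\exp\left\{0.5\,\|\gamma u^0\|_{L^2}^2\right\}\|v_0\|_2,$$ where $\lambda_{0,i}$ is the eigenvalue of $P_0$ associated with $p_{0,i}$.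
   Context: $A,N_1,\ldots,N_m\in\mathbb R^{n\times n}$, $X_0\in\mathbb R^{n\times q}$, $v_0\in\mathbb R^q$; $A$ is Hurwitz, i.e. $\sigma(A)\subset\mathbb C_-=\{z\in\mathbb C:\Re(z)<0\}$ ($\sigma(\cdot)$ is the spectrum). The control $u=(u_1,\ldots,u_m)^\top:[0,\infty)\to\mathbb R^m$ lies in $L^2$, with $\|f\|_{L^2}^2=\int_0^\infty\|f(s)\|_2^2\,ds$. The function $u^0=(u_1^0,\ldots,u_m^0)^\top$ is given by $u_k^0\equiv0$ if $N_k=0$ and $u_k^0=u_k$ otherwise. The Gramian is $P_0=\int_0^\infty Z_\gamma(s)\,ds$, where $\dot Z_\gamma(t)=AZ_\gamma(t)+Z_\gamma(t)A^\top+\frac1{\gamma^2}\sum_{k=1}^mN_kZ_\gamma(t)N_k^\top$, $Z_\gamma(0)=X_0X_0^\top$; equivalently, $P_0$ solves $AP_0+P_0A^\top+\frac1{\gamma^2}\sum_{k=1}^mN_kP_0N_k^\top=-X_0X_0^\top$. *)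

(* Defs.v *)
From HB Require Import structures.
From mathcomp Require Import all_boot all_order all_algebra.
From mathcomp Require Import mxtens complex.
From mathcomp Require Import all_classical all_reals all_analysis.

Set Implicit Arguments.
Unset Strict Implicit.
Unset Printing Implicit Defensive.

Import Order.TTheory GRing.Theory Num.Theory.
Import numFieldNormedType.Exports.

Local Open Scope classical_set_scope.
Local Open Scope ring_scope.

Definition dotprod (R : realType) (n : nat) (x y : 'cV[R]_n) : R :=
  \sum_(i < n) x i 0 * y i 0.

(* The library norm on 'cV[R]_n is the sup norm, hence this one. *)
Definition norm2 (R : realType) (n : nat) (x : 'cV[R]_n) : R :=
  Num.sqrt (dotprod x x).

(* Norm of L^2([0, +oo[) for real functions; a vector-valued f has L2 norm
   L2norm (fun s => norm2 (f s)). It is +oo when f is not square integrable. *)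
Definition L2norm (R : realType) (f : R -> R) : \bar R :=
  ((\int[lebesgue_measure]_(s in `[0%R, +oo[) ((f s) ^+ 2)%:E) `^ 2^-1)%E.

Definition in_L2 (R : realType) (n : nat) (f : R -> 'cV[R]_n) : Prop :=
  (forall i, measurable_fun (`[0, +oo[ : set R) (fun s => f s i 0)) /\
  (L2norm (fun s => norm2 (f s)) < +oo)%E.

(* eigenvalue is defined through row vectors; the spectrum is the same. *)
Definition spectrum (R : realType) (n : nat) (M : 'M[R]_n) : set R[i] :=
  [set z | eigenvalue (map_mx (real_complex R) M) z].

Definition left_half_plane (R : realType) : set R[i] :=
  [set z | complex.Re z < 0].

Definition hurwitz (R : realType) (n : nat) (M : 'M[R]_n) : Prop :=
  spectrum M `<=` @left_half_plane R.

(* Solutions of x' = F t x, x 0 = x0, on [0, +oo[ when F is only measurable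
   in t: x is absolutely continuous on compact intervals and x' = F t x almost
   everywhere, i.e. x is the Lebesgue integral of t |-> F t (x t). *)
Definition caratheodory_solution (R : realType) (n : nat)
    (F : R -> 'cV[R]_n -> 'cV[R]_n) (x0 : 'cV[R]_n) (x : R -> 'cV[R]_n) : Prop :=
  forall t : R, 0 <= t ->
    (forall i, lebesgue_measure.-integrable `[0, t]
                 (fun s => (F s (x s) i 0)%:E)) /\
    x t = x0 + \col_i \int[lebesgue_measure]_(s in `[0, t]) F s (x s) i 0.

(* By continuity of F \o z the equation also holds at 0, with the right
   derivative, in all uses where F is continuous. *)
Definition classical_solution (R : realType) (m n : nat)
    (F : 'M[R]_(m, n) -> 'M[R]_(m, n)) (z0 : 'M[R]_(m, n))
    (z : R -> 'M[R]_(m, n)) : Prop :=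
  [/\ z 0 = z0,
      {within (`[0, +oo[ : set R), continuous z} &
      forall t : R, 0 < t -> is_derive t 1 z (F (z t))].

Definition bilinear_rhs (R : realType) (n m : nat) (A : 'M[R]_n)
    (N : 'I_m -> 'M[R]_n) (u : R -> 'cV[R]_m) (t : R) (x : 'cV[R]_n) : 'cV[R]_n :=
  A *m x + \sum_(k < m) u t k 0 *: (N k *m x).

Definition lyapunov_op (R : realType) (n m : nat) (A : 'M[R]_n)
    (N : 'I_m -> 'M[R]_n) (gamma : R) (Z : 'M[R]_n) : 'M[R]_n :=
  A *m Z + Z *m A^T + gamma ^- 2 *: \sum_(k < m) N k *m Z *m (N k)^T.

Definition lyapunov_kron (R : realType) (n m : nat) (A : 'M[R]_n)
    (N : 'I_m -> 'M[R]_n) (gamma : R) : 'M[R]_(n * n) :=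
  A *t (1%:M : 'M[R]_n) + (1%:M : 'M[R]_n) *t A
    + gamma ^- 2 *: \sum_(k < m) N k *t N k.

Definition active_control (R : realType) (n m : nat) (N : 'I_m -> 'M[R]_n)
    (u : R -> 'cV[R]_m) (t : R) : 'cV[R]_m :=
  \col_k (if N k == 0 then 0 else u t k 0).

Definition gramian (R : realType) (n : nat) (Z : R -> 'M[R]_n) : 'M[R]_n :=
  \matrix_(i, j) \int[lebesgue_measure]_(s in `[0, +oo[) Z s i j.

(* n orthonormal vectors of R^n are independent, so they form a basis. *)
Definition orthonormal_basis (R : realType) (n : nat) (p : 'I_n -> 'cV[R]_n) :=
  forall i j, dotprod (p i) (p j) = (i == j)%:R.

(* Main.v *)
(* Let w be the active part u^0 of the control and L the Lyapunov operator, so that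
   Z' = L(Z). The heart of the proof is the inequality of quadratic forms
     x(t) x(t)^T <= |v0|^2 exp(gamma^2 int_0^t |w|^2) Z(t).
   It is proved along the explicit Euler scheme with step h. One step of the scheme for
   x x^T is, by a weighted Cauchy-Schwarz inequality, at most
   (1 + gamma^2 int |w|^2) times the positive map
     Phi(Y) = (I + hA) Y (I + hA)^T + h gamma^-2 sum_k N_k Y N_k^T,
   which is one step of the scheme for Z up to h^2; the accumulated errors are O(h). No
   product rule for absolutely continuous functions is needed.
   Testing with p_i and integrating over time gives the claim, once Z is known to be
   integrable. For this, factor the characteristic polynomial of the Hurwitz matrix
   lyapunov_kron over its eigenvalues: by Cayley-Hamilton the successive vectors
   prod_j (K - mu_j) vec(Z) end in 0, and going backwards each of them solves
   y' = mu_j y + (next vector), hence decays exponentially. *)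
Require Import Defs.
From HB Require Import structures.
From mathcomp Require Import all_boot all_order all_algebra.
From mathcomp Require Import mxtens complex.
From mathcomp Require Import all_classical all_reals all_analysis.
From mathcomp Require Import measurable_realfun ring lra.

Set Implicit Arguments.
Unset Strict Implicit.
Unset Printing Implicit Defensive.

Import Order.TTheory GRing.Theory Num.Theory.
Import numFieldNormedType.Exports.

Local Open Scope classical_set_scope.
Local Open Scope ring_scope.

(** * Entrywise norms, quadratic forms and Cauchy-Schwarz inequalities *)

Definition l1norm (R : realType) (n : nat) (q : 'cV[R]_n) : R :=
  \sum_(i < n) `|q i 0|.

(** A crude bound for the operator norm of a matrix, valid for the l1 norm ([l1norm_trmx_mul]) as
    well as for the sup norm ([mulmx_le]). *)
Definition mxabs (R : realType) (m n : nat) (M : 'M[R]_(m, n)) : R :=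
  \sum_(i < m) \sum_(j < n) `|M i j|.

Definition quadform (R : realType) (n : nat) (M : 'M[R]_n) (q : 'cV[R]_n) : R :=
  dotprod q (M *m q).

Section LinearAlgebra.
Variable R : realType.

Lemma l1norm_ge0 n (q : 'cV[R]_n) : 0 <= l1norm q.
Proof. by apply: sumr_ge0. Qed.

Lemma mxabs_ge0 m n (M : 'M[R]_(m, n)) : 0 <= mxabs M.
Proof. by apply: sumr_ge0 => i _; apply: sumr_ge0. Qed.

Lemma entry_le_mxabs m n (M : 'M[R]_(m, n)) i j : `|M i j| <= mxabs M.
Proof.
rewrite /mxabs (bigD1 i) //= (bigD1 j) //= -addrA lerDl addr_ge0 //.
  by apply: sumr_ge0.
by apply: sumr_ge0 => k _; apply: sumr_ge0.
Qed.

Lemma l1normD n (p q : 'cV[R]_n) : l1norm (p + q) <= l1norm p + l1norm q.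
Proof.
by rewrite /l1norm -big_split; apply: ler_sum => i _; rewrite mxE ler_normD.
Qed.

Lemma l1normZ n (a : R) (q : 'cV[R]_n) : l1norm (a *: q) = `|a| * l1norm q.
Proof. by rewrite /l1norm mulr_sumr; apply: eq_bigr => i _; rewrite mxE normrM. Qed.

Lemma l1norm_trmx_mul m n (M : 'M[R]_(m, n)) q :
  l1norm (M^T *m q) <= mxabs M * l1norm q.
Proof.
rewrite /l1norm /mxabs exchange_big mulr_suml; apply: ler_sum => j _ /=.
rewrite mxE mulr_suml (le_trans (ler_norm_sum _ _ _))//; apply: ler_sum => i _.
rewrite mxE normrM ler_wpM2l // (bigD1 i) //= lerDl; exact: sumr_ge0.
Qed.

Lemma dotprodDr n (q x y : 'cV[R]_n) : dotprod q (x + y) = dotprod q x + dotprod q y.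
Proof. by rewrite /dotprod -big_split; apply: eq_bigr => i _; rewrite mxE mulrDr. Qed.

Lemma dotprodZr n (q x : 'cV[R]_n) a : dotprod q (a *: x) = a * dotprod q x.
Proof. by rewrite /dotprod mulr_sumr; apply: eq_bigr => i _; rewrite mxE mulrCA. Qed.

Lemma dotprod0r n (q : 'cV[R]_n) : dotprod q 0 = 0.
Proof. by rewrite /dotprod big1 // => i _; rewrite mxE mulr0. Qed.

Lemma dotprod_sumr n (I : finType) (q : 'cV[R]_n) (x : I -> 'cV[R]_n) :
  dotprod q (\sum_k x k) = \sum_k dotprod q (x k).
Proof.
exact: (big_morph (dotprod q) (dotprodDr q) (dotprod0r q)).
Qed.

Lemma dotprodC n (x y : 'cV[R]_n) : dotprod x y = dotprod y x.
Proof. by apply: eq_bigr => i _; rewrite mulrC. Qed.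

Lemma dotprodE n (x y : 'cV[R]_n) : dotprod x y = (x^T *m y) 0 0.
Proof. by rewrite mxE; apply: eq_bigr => i _; rewrite mxE. Qed.

Lemma dotprod_mulmx m n (M : 'M[R]_(m, n)) q x :
  dotprod q (M *m x) = dotprod (M^T *m q) x.
Proof. by rewrite !dotprodE trmx_mul trmxK mulmxA. Qed.

Lemma dotprod_le n (q e : 'cV[R]_n) c :
  (forall i, `|e i 0| <= c) -> `|dotprod q e| <= c * l1norm q.
Proof.
move=> ec; rewrite (le_trans (ler_norm_sum _ _ _)) // mulr_sumr.
by apply: ler_sum => i _; rewrite normrM mulrC ler_wpM2r.
Qed.

Lemma quadformD n (M M' : 'M[R]_n) q : quadform (M + M') q = quadform M q + quadform M' q.
Proof. by rewrite /quadform mulmxDl dotprodDr. Qed.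

Lemma quadformZ n (M : 'M[R]_n) a q : quadform (a *: M) q = a * quadform M q.
Proof. by rewrite /quadform -scalemxAl dotprodZr. Qed.

Lemma quadform_sum n (I : finType) (M : I -> 'M[R]_n) q :
  quadform (\sum_k M k) q = \sum_k quadform (M k) q.
Proof. by rewrite /quadform mulmx_suml dotprod_sumr. Qed.

Lemma quadform_congr m n (B : 'M[R]_(m, n)) (M : 'M[R]_n) q :
  quadform (B *m M *m B^T) q = quadform M (B^T *m q).
Proof. by rewrite /quadform -!mulmxA dotprod_mulmx. Qed.

Lemma quadform_le n (M : 'M[R]_n) c q :
  (forall i j, `|M i j| <= c) -> `|quadform M q| <= c * l1norm q ^+ 2.
Proof.
move=> Mc; rewrite expr2 mulrA; apply: dotprod_le => i.
rewrite mxE (le_trans (ler_norm_sum _ _ _)) // mulr_sumr.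
by apply: ler_sum => j _; rewrite normrM ler_wpM2r.
Qed.

(** Lagrange's identity: twice the difference of the two sides is the sum of the squares of all
    minors a_k b_l - a_l b_k. *)
Lemma cauchy_schwarz_sum (I : finType) (a b : I -> R) :
  (\sum_k a k * b k) ^+ 2 <= (\sum_k a k ^+ 2) * (\sum_k b k ^+ 2).
Proof.
have : 0 <= \sum_k \sum_l (a k * b l - a l * b k) ^+ 2.
  by apply: sumr_ge0 => k _; apply: sumr_ge0 => l _; exact: sqr_ge0.
have -> : \sum_k \sum_l (a k * b l - a l * b k) ^+ 2 =
    2 * ((\sum_k a k ^+ 2) * (\sum_k b k ^+ 2) - (\sum_k a k * b k) ^+ 2).
  transitivity (\sum_k \sum_l (a k ^+ 2 * b l ^+ 2) +
    \sum_k \sum_l (a l ^+ 2 * b k ^+ 2) - 2 * \sum_k \sum_l (a k * b k) * (a l * b l)).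
    rewrite mulr_sumr -sumrN -!big_split; apply: eq_bigr => k _ /=.
    rewrite mulr_sumr -sumrN -!big_split; apply: eq_bigr => l _ /=; ring.
  rewrite (exchange_big _ _ _ _ _ (fun k l => a l ^+ 2 * b k ^+ 2)) /=.
  rewrite expr2 !big_distrlr /=; ring.
by rewrite pmulr_rge0 // subr_ge0.
Qed.

(** Cauchy-Schwarz for the vectors (1, sqrt(w) a) and (b0, b / sqrt(w)). The free weight [w] is what
    lets the step size and [gamma] enter in the right places. *)
Lemma weighted_cauchy_schwarz (I : finType) (a b : I -> R) (b0 w : R) : 0 < w ->
  (b0 + \sum_k a k * b k) ^+ 2 <=
    (1 + w * \sum_k a k ^+ 2) * (b0 ^+ 2 + w^-1 * \sum_k b k ^+ 2).
Proof.
move=> w0; have cs := cauchy_schwarz_sum a b.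
have ag : 2 * b0 * (\sum_k a k * b k) <=
    w * b0 ^+ 2 * (\sum_k a k ^+ 2) + w^-1 * \sum_k b k ^+ 2.
  rewrite !mulr_sumr -big_split; apply: ler_sum => k _ /=.
  have := sqr_ge0 (w * b0 * a k - b k).
  rewrite -(pmulr_rge0 _ (_ : 0 < w^-1)) ?invr_gt0 // => h.
  rewrite -subr_ge0; apply: le_trans h _; rewrite le_eqVlt; apply/orP; left.
  by apply/eqP; field; rewrite gt_eqF.
set S := \sum_k a k * b k in cs ag *.
set P := \sum_k a k ^+ 2 in cs ag *.
set Q := \sum_k b k ^+ 2 in cs ag *.
have -> : (1 + w * P) * (b0 ^+ 2 + w^-1 * Q) =
   b0 ^+ 2 + (w * b0 ^+ 2 * P + w^-1 * Q) + P * Q by field; rewrite gt_eqF.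
have -> : (b0 + S) ^+ 2 = b0 ^+ 2 + 2 * b0 * S + S ^+ 2 by ring.
by rewrite !lerD.
Qed.

End LinearAlgebra.

(** * One step of the Euler scheme for the quadratic forms *)

Section EulerStep.
Variables (R : realType) (n m : nat) (A : 'M[R]_n) (N : 'I_m -> 'M[R]_n) (gamma : R).
Hypothesis gamma_gt0 : 0 < gamma.

(** The rate at which an error proportional to [l1norm q ^+ 2] can grow in one step of length at
    most [T], when [q] is replaced by (I + hA)^T q and by the N_k^T q. *)
Definition growth_rate (T : R) : R :=
  2 * mxabs A + T * mxabs A ^+ 2 + gamma ^- 2 * \sum_k mxabs (N k) ^+ 2.

Lemma growth_rate_ge0 T : 0 <= T -> 0 <= growth_rate T.
Proof.
move=> T0; rewrite /growth_rate !addr_ge0 ?mulr_ge0 ?mxabs_ge0 ?sqr_ge0 //.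
  by rewrite invr_ge0 sqr_ge0.
by apply: sumr_ge0 => k _; exact: sqr_ge0.
Qed.

(* The map Phi Z = (I + hA) Z (I + hA)^T + h gamma^-2 sum_k N_k Z N_k^T preserves
   positivity and agrees with Z + h L(Z) up to h^2. *)
Lemma euler_step (h T dV E rho a b c d : R) (U : 'I_m -> R) (x y : 'cV[R]_n)
    (Z Z' : 'M[R]_n) :
  0 < h -> h <= T -> 0 <= dV -> \sum_k U k ^+ 2 <= h * dV ->
  0 <= E -> 0 <= rho -> 
  (forall q, dotprod q x ^+ 2 <= E * quadform Z q + rho * l1norm q ^+ 2) ->
  (forall i, `|(y - (x + h *: (A *m x) + \sum_k U k *: (N k *m x))) i 0| <= a) ->
  (forall i, `|y i 0| <= b) ->
  (forall i j, `|(Z' - Z - h *: lyapunov_op A N gamma Z) i j| <= c) ->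
  (forall i j, `|Z i j| <= d) -> 0 <= a -> 0 <= b -> 0 <= d ->
  forall q, dotprod q y ^+ 2 <= (1 + gamma ^+ 2 * dV) * E * quadform Z' q
    + ((1 + gamma ^+ 2 * dV) * (rho * (1 + growth_rate T * h)
         + E * (c + h ^+ 2 * (mxabs A ^+ 2 * d))) + 2 * a * b) * l1norm q ^+ 2.
Proof.
move=> h0 hT dV0 UV E0 rho0 Hx He Hy HZ Hd a0 b0 d0 q.
set e := y - _ in He.
pose B := 1%:M + h *: A.
pose y0 := dotprod (B^T *m q) x.
pose yk k := dotprod ((N k)^T *m q) x.
(* With this weight, w^-1 = h gamma^-2 is exactly the coefficient of the terms N_k Z N_k^T in Phi,
   while w sum_k U_k^2 is at most gamma^2 dV because sum_k U_k^2 <= h dV. *)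
pose w := gamma ^+ 2 / h.
have w0 : 0 < w by rewrite divr_gt0 // exprn_gt0.
have winv : w^-1 = h * gamma ^- 2 by rewrite /w invf_div.
have yE : dotprod q y = (y0 + \sum_k U k * yk k) + dotprod q e.
  have -> : y = (B *m x + \sum_k U k *: (N k *m x)) + e.
    by rewrite /B mulmxDl mul1mx -scalemxAl /e addrC subrK.
  rewrite !dotprodDr dotprod_sumr dotprod_mulmx; congr (_ + _ + _).
  by apply: eq_bigr => k _; rewrite dotprodZr dotprod_mulmx.
have dy := dotprod_le q Hy; have de := dotprod_le q He.
set l := l1norm q in dy de *.
have l0 : 0 <= l by exact: l1norm_ge0.
(* Removing the consistency error e: (Y - e)^2 >= Y^2 - 2 Y e, where |Y| <= b l and |e| <= a l. *)
have step1 : dotprod q y ^+ 2 <= (y0 + \sum_k U k * yk k) ^+ 2 + 2 * a * b * l ^+ 2.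
  have -> : y0 + \sum_k U k * yk k = dotprod q y - dotprod q e by rewrite yE addrK.
  have : dotprod q y * dotprod q e <= (b * l) * (a * l).
    by rewrite (le_trans (ler_norm _)) // normrM ler_pM.
  have := sqr_ge0 (dotprod q e); nra.
apply: (le_trans step1); rewrite [X in _ <= _ + X]mulrDl [leRHS]addrA lerD2r.
apply: (le_trans (weighted_cauchy_schwarz U yk y0 w0)).
have wU : w * \sum_k U k ^+ 2 <= gamma ^+ 2 * dV.
  rewrite (le_trans (ler_wpM2l (ltW w0) UV)) // /w mulrA mulfVK //.
  by rewrite gt_eqF.
have K0 : 0 <= 1 + gamma ^+ 2 * dV by rewrite addr_ge0 // mulr_ge0 // sqr_ge0.
have w10 : 0 <= w^-1 by rewrite invr_ge0 ltW.
have pos : 0 <= y0 ^+ 2 + w^-1 * \sum_k yk k ^+ 2.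
  rewrite addr_ge0 ?sqr_ge0 // mulr_ge0 //.
  by apply: sumr_ge0 => k _; exact: sqr_ge0.
have := ler_wpM2r pos (_ : 1 + w * \sum_k U k ^+ 2 <= 1 + gamma ^+ 2 * dV).
rewrite lerD2l => /(_ wU) /le_trans; apply.
rewrite -(mulrA _ E) -(mulrA _ _ (l ^+ 2)) -mulrDr ler_wpM2l //.
have H0 := Hx (B^T *m q).
have Hk : w^-1 * \sum_k yk k ^+ 2 <=
   w^-1 * (E * \sum_k quadform Z ((N k)^T *m q) + rho * (\sum_k mxabs (N k) ^+ 2 * l ^+ 2)).
  rewrite ler_wpM2l // !mulr_sumr -big_split; apply: ler_sum => k _ /=.
  rewrite (le_trans (Hx _)) // lerD2l ler_wpM2l // -exprMn.
  by rewrite ler_sqr ?nnegrE ?l1norm_ge0 ?mulr_ge0 ?mxabs_ge0 // l1norm_trmx_mul.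
have lB : l1norm (B^T *m q) <= (1 + h * mxabs A) * l.
  rewrite /B linearD /= linearZ /= trmx1 mulmxDl mul1mx -scalemxAl mulrDl mul1r.
  rewrite (le_trans (l1normD _ _)) // lerD2l l1normZ gtr0_norm // -mulrA.
  by rewrite ler_pM2l // l1norm_trmx_mul.
have lB2 : l1norm (B^T *m q) ^+ 2 <= (1 + h * mxabs A) ^+ 2 * l ^+ 2.
  by rewrite -exprMn ler_sqr ?nnegrE ?l1norm_ge0 ?mulr_ge0 ?addr_ge0 ?mulr_ge0 ?mxabs_ge0 // ltW.
(* The left side is the form of Phi(Z), and Phi(Z) = Z + h L(Z) + h^2 A Z A^T. The middle term on
   the right is the defect of [Z'] from Z + h L(Z). *)
have PhiZ : quadform Z (B^T *m q) + w^-1 * \sum_k quadform Z ((N k)^T *m q) =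
    quadform Z' q - quadform (Z' - Z - h *: lyapunov_op A N gamma Z) q
    + h ^+ 2 * quadform (A *m Z *m A^T) q.
  under eq_bigr do rewrite -quadform_congr.
  rewrite -!quadform_congr -quadform_sum -!quadformZ -mulN1r -quadformZ -!quadformD.
  congr (dotprod q (_ *m q)).
  rewrite /B /lyapunov_op winv linearD /= linearZ /= trmx1.
  rewrite !mulmxDl !mulmxDr !mul1mx !mulmx1 -?scalemxAl -?scalemxAr -?scalemxAl -?scalemxAr ?scalerA.
  move: (A *m Z) (Z *m A^T) (A *m Z *m A^T) (\sum_k _) => M1 M2 M3 M4.
  by apply/matrixP => i j; rewrite !mxE; ring.
have rest : - quadform (Z' - Z - h *: lyapunov_op A N gamma Z) q
    + h ^+ 2 * quadform (A *m Z *m A^T) q <= (c + h ^+ 2 * (mxabs A ^+ 2 * d)) * l ^+ 2.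
  rewrite mulrDl lerD //.
    by rewrite (le_trans (ler_norm _)) // normrN quadform_le.
  rewrite -mulrA ler_wpM2l ?sqr_ge0 // quadform_congr.
  rewrite (le_trans (ler_norm _)) // (le_trans (quadform_le _ Hd)) //.
  rewrite [leRHS]mulrAC -exprMn [leRHS]mulrC.
  rewrite ler_wpM2l // ler_sqr ?nnegrE ?l1norm_ge0 ?mulr_ge0 ?mxabs_ge0 //.
  exact: l1norm_trmx_mul.
(* The square contributes h^2 [mxabs A ^+ 2], which h <= T turns into a term linear in h. *)
have rates : (1 + h * mxabs A) ^+ 2 + w^-1 * \sum_k mxabs (N k) ^+ 2 <= 1 + growth_rate T * h.
  rewrite /growth_rate winv; have := sqr_ge0 (mxabs A); nra.
have := lerD H0 Hk; move/le_trans; apply.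
have rl : rho * l1norm (B^T *m q) ^+ 2 <= rho * ((1 + h * mxabs A) ^+ 2 * l ^+ 2).
  by rewrite ler_wpM2l.
have Er := ler_wpM2l E0 rest.
have rr : rho * l ^+ 2 * ((1 + h * mxabs A) ^+ 2 + w^-1 * \sum_k mxabs (N k) ^+ 2)
   <= rho * l ^+ 2 * (1 + growth_rate T * h).
  by rewrite ler_wpM2l // mulr_ge0 // sqr_ge0.
rewrite -mulr_suml.
move: PhiZ => /(congr1 (fun z => E * z)); lra.
Qed.
End EulerStep.

(** * Iteration of the Euler step and passage to the limit *)

Lemma le_of_le_addn_inv (R : realType) (a b M : R) :
  (forall k : nat, a <= b + M / k.+1%:R) -> a <= b.
Proof.
move=> H; apply/ler_addgt0Pr => e e0.
have [M0|M0] := leP M 0.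
  apply: (le_trans (H 0%N)); rewrite divr1 lerD2l (le_trans M0) //; exact: ltW.
have [k kP] : exists k : nat, M / e < k.+1%:R.
  exists (Num.trunc (M / e)); exact: truncnS_gt.
apply: (le_trans (H k)); rewrite lerD2l ler_pdivrMr // mulrC.
by rewrite -ler_pdivrMr // ltW.
Qed.

Section Comparison.
Variables (R : realType) (n m : nat) (A : 'M[R]_n) (N : 'I_m -> 'M[R]_n) (gamma : R).
Variables (x : R -> 'cV[R]_n) (Z : R -> 'M[R]_n) (V : R -> R) (E0 C T : R).
Hypotheses (gamma_gt0 : 0 < gamma) (E0_gt0 : 0 < E0) (C_ge0 : 0 <= C) (T_ge0 : 0 <= T).
Hypothesis initial : forall q, dotprod q (x 0) ^+ 2 <= E0 * quadform (Z 0) q.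
Hypothesis V_nd : forall s t, 0 <= s -> s <= t -> t <= T -> V s <= V t.
Hypothesis x_le : forall s i, 0 <= s -> s <= T -> `|x s i 0| <= C.
Hypothesis Z_le : forall s i j, 0 <= s -> s <= T -> `|Z s i j| <= C.
Hypothesis Z_step : forall s t i j, 0 <= s -> s <= t -> t <= T ->
  `|(Z t - Z s - (t - s) *: lyapunov_op A N gamma (Z s)) i j| <= C * (t - s) ^+ 2.
Hypothesis x_step : forall s t, 0 <= s -> s <= t -> t <= T -> exists U : 'I_m -> R,
  \sum_k U k ^+ 2 <= (t - s) * (V t - V s) /\
  forall i, `|(x t - (x s + (t - s) *: (A *m x s) + \sum_k U k *: (N k *m x s))) i 0|
    <= C * (t - s) * (t - s + (V t - V s)).

(** The clock [G] is elapsed time plus control energy. A step of length h creates a new error of at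
    most h [K] times the increment of [G], and multiplies the old one by at most the exponential of
    [kappa] times that increment. [Em] dominates all the multipliers E. *)
Let kappa := gamma ^+ 2 + growth_rate A N gamma T.
Let Em := E0 * expR (gamma ^+ 2 * (V T - V 0)).
Let K := Em * (C * (1 + mxabs A ^+ 2)) + 2 * C ^+ 2.
Let G t := t + (V t - V 0).

(** The multiplier E, a product of factors 1 + gamma^2 dV, has to remain existential: the sign of
    [quadform (Z _) q] is not known yet, so E cannot be replaced by its upper bound inside the
    inequality. The lower bound E0 <= E serves later to divide by E. *)
Lemma euler_induction (h : R) (j : nat) : 0 < h -> j%:R * h <= T ->
  exists E, [/\ E0 <= E, E <= E0 * expR (gamma ^+ 2 * (V (j%:R * h) - V 0)) &
    forall q, dotprod q (x (j%:R * h)) ^+ 2 <= E * quadform (Z (j%:R * h)) q +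
      h * K * G (j%:R * h) * expR (kappa * G (j%:R * h)) * l1norm q ^+ 2].
Proof.
move=> h0; elim: j => [|j IH] jT.
  exists E0; rewrite mul0r /G !subrr !mulr0 expR0 mulr1; split => // q.
  by rewrite addr0 mulr0 mul0r mul0r addr0.
set s := j%:R * h in IH *; set t := j.+1%:R * h in jT *.
have s0 : 0 <= s by rewrite mulr_ge0 // ltW.
have tsh : t - s = h by rewrite /t /s -mulrBl -natrB // subSnn mul1r.
have st : s <= t by rewrite -subr_ge0 tsh ltW.
have sT := le_trans st jT.
have t0 := le_trans s0 st.
have [E [EE0 EE1 HE]] := IH sT.
have [U [UV xU]] := x_step s0 st jT.
set dV := V t - V s in UV xU.
have dV0 : 0 <= dV by rewrite subr_ge0 V_nd.
rewrite !tsh in UV xU.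
have r0 : 0 <= growth_rate A N gamma T by exact: growth_rate_ge0.
have k0 : 0 <= kappa by rewrite addr_ge0 // ?sqr_ge0 ?expR_ge0 ?mxabs_ge0 ?(ltW E0_gt0).
have Em0 : 0 <= Em by rewrite mulr_ge0 // ?expR_ge0 // ltW.
have K0 : 0 <= K.
  by rewrite addr_ge0 // !mulr_ge0 // ?addr_ge0 // ?sqr_ge0 ?expR_ge0 ?mxabs_ge0 ?(ltW E0_gt0).
have Gs0 : 0 <= G s by rewrite /G addr_ge0 // subr_ge0 V_nd.
have hT : h <= T by rewrite (le_trans _ jT) // -tsh lerBlDr lerDl.
have E_ge0 : 0 <= E by rewrite (le_trans _ EE0) // ltW.
set rho := h * K * G s * expR (kappa * G s) in HE.
have rho0 : 0 <= rho by rewrite !mulr_ge0 ?expR_ge0 // ltW.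
have g1 : 1 + gamma ^+ 2 * dV <= expR (gamma ^+ 2 * dV) by exact: expR_ge1Dx.
have g0 : 1 <= 1 + gamma ^+ 2 * dV by rewrite lerDl mulr_ge0 // ?sqr_ge0 ?expR_ge0 ?mxabs_ge0 ?(ltW E0_gt0).
have E'up : (1 + gamma ^+ 2 * dV) * E <= E0 * expR (gamma ^+ 2 * (V t - V 0)).
  have -> : gamma ^+ 2 * (V t - V 0) = gamma ^+ 2 * dV + gamma ^+ 2 * (V s - V 0).
    by rewrite /dV; ring.
  rewrite expRD mulrCA ler_pM // (le_trans _ g0) //.
exists ((1 + gamma ^+ 2 * dV) * E); split => //.
  by rewrite (le_trans EE0) // ler_peMl.
move=> q.
have Zs i k : `|(Z t - Z s - h *: lyapunov_op A N gamma (Z s)) i k| <= C * h ^+ 2.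
  by have := Z_step i k s0 st jT; rewrite tsh.
have hdV : 0 <= h + dV by rewrite addr_ge0 // ltW.
have a0 : 0 <= C * h * (h + dV) by rewrite !mulr_ge0 // ltW.
have := euler_step gamma_gt0 h0 hT dV0 UV E_ge0 rho0 HE xU (fun i => x_le i t0 jT) Zs
  (fun i k => Z_le i k s0 sT) a0 C_ge0 C_ge0 q.
move/le_trans; apply; rewrite lerD2l ler_wpM2r ?sqr_ge0 //.
have GG : G t = G s + (h + dV) by rewrite /G /dV -tsh; ring.
(* Both factors are bounded by 1 + y <= exp y; the sum of the exponents is at most [kappa] times the
   increment of the clock. *)
have main : (1 + gamma ^+ 2 * dV) * (1 + growth_rate A N gamma T * h) <= expR (kappa * (h + dV)).
  have e1 : 1 + growth_rate A N gamma T * h <= expR (growth_rate A N gamma T * h).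
    exact: expR_ge1Dx.
  apply: (@le_trans _ _ (expR (gamma ^+ 2 * dV) * expR (growth_rate A N gamma T * h))).
    rewrite ler_pM // ?(le_trans _ g0) // addr_ge0 // mulr_ge0 // ltW //.
  rewrite -expRD ler_expR /kappa.
  have := mulr_ge0 (sqr_ge0 gamma) (ltW h0); have := mulr_ge0 r0 dV0; lra.
have m1 := ler_wpM2l rho0 main.
have E'm : (1 + gamma ^+ 2 * dV) * E <= Em.
  rewrite (le_trans E'up) // ler_wpM2l ?(ltW E0_gt0) // ler_expR.
  by rewrite ler_wpM2l ?sqr_ge0 // lerD2r V_nd.
have c0 : 0 <= C * (1 + mxabs A ^+ 2) * h ^+ 2.
  by rewrite mulr_ge0 ?sqr_ge0 // mulr_ge0 // addr_ge0 ?sqr_ge0.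
have m2 := ler_wpM2r c0 E'm.
have m3 : Em * (C * (1 + mxabs A ^+ 2)) * (h * h) <= Em * (C * (1 + mxabs A ^+ 2)) * (h * (h + dV)).
  apply: ler_wpM2l; last by rewrite ler_pM2l // lerDl.
  by rewrite mulr_ge0 // mulr_ge0 // addr_ge0 ?sqr_ge0.
(* Discrete Gronwall: the old error is propagated by the exponential factor, and the newly created
   one may be multiplied by expR (kappa * G t) >= 1. *)
have m4 : rho * expR (kappa * (h + dV)) + h * K * (h + dV) <= h * K * G t * expR (kappa * G t).
  have -> : rho * expR (kappa * (h + dV)) = h * K * G s * expR (kappa * G t).
    by rewrite /rho GG (mulrDr kappa (G s)) expRD mulrA.
  have ex1 : 1 <= expR (kappa * G t).
    by rewrite -expR0 ler_expR mulr_ge0 // GG addr_ge0.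
  have hK : 0 <= h * K * (h + dV) by rewrite !mulr_ge0 // ltW.
  have := ler_wpM2l hK ex1; rewrite mulr1.
  move: (expR (kappa * G t)) => ex; rewrite GG; lra.
apply: le_trans m4; rewrite /K; lra.
Qed.

Lemma euler_comparison q :
  dotprod q (x T) ^+ 2 <= E0 * expR (gamma ^+ 2 * (V T - V 0)) * quadform (Z T) q.
Proof.
have [T0|T0] := eqVneq T 0.
  by rewrite T0 subrr mulr0 expR0 mulr1.
have T_gt0 : 0 < T by rewrite lt_neqAle eq_sym T0.
pose M := T * K * G T * expR (kappa * G T) * l1norm q ^+ 2.
have Gk (k : nat) : exists E, [/\ E0 <= E, E <= Em &
    dotprod q (x T) ^+ 2 <= E * quadform (Z T) q + M / k.+1%:R].
  have kT : k.+1%:R * (T / k.+1%:R) = T by rewrite mulrC mulfVK.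
  have h0 : 0 < T / k.+1%:R by rewrite divr_gt0.
  have [|E []] := @euler_induction (T / k.+1%:R) k.+1 h0; rewrite kT // => e1 e2 e3.
  exists E; split => //; apply: (le_trans (e3 q)); rewrite lerD2l /M.
  by rewrite le_eqVlt; apply/orP; left; apply/eqP; field; rewrite -(natrD _ 1 k) pnatr_eq0.
have K0 : 0 <= K.
  by rewrite addr_ge0 // !mulr_ge0 // ?addr_ge0 // ?expR_ge0 // ?sqr_ge0 // ltW.
have M0 : 0 <= M.
  have GT0 : 0 <= G T by rewrite addr_ge0 // subr_ge0 V_nd.
  by rewrite !mulr_ge0 ?l1norm_ge0 ?expR_ge0.
(* Positivity comes from the comparison itself: the left side is a square, so dividing by E >= E0
   and refining the grid gives it. Only after that may E be enlarged to [Em]. *)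
have Z0 : 0 <= quadform (Z T) q.
  apply: (@le_of_le_addn_inv _ _ _ (M / E0)) => k.
  have [E [EE0 _ H]] := Gk k.
  have Ep : 0 < E by exact: lt_le_trans EE0.
  have : 0 <= quadform (Z T) q + M / k.+1%:R / E.
    rewrite -(pmulr_rge0 _ Ep) mulrDr (mulrCA E) mulfV ?mulr1 ?gt_eqF //.
    by rewrite (le_trans _ H) // ?sqr_ge0 ?expR_ge0 ?mxabs_ge0 ?(ltW E0_gt0).
  move/le_trans; apply; rewrite lerD2l mulrAC ler_wpM2r //.
  by rewrite ler_wpM2l // lef_pV2.
apply: (@le_of_le_addn_inv _ _ _ M) => k; have [E [_ EEm H]] := Gk k.
by rewrite (le_trans H) // lerD2r ler_wpM2r.
Qed.

End Comparison.

(** * Entrywise regularity and Euler error of classical solutions *)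

Lemma is_derive_entry (R : realType) (m n : nat) (z : R -> 'M[R]_(m, n)) (t : R) (D : 'M[R]_(m, n)) i j :
  is_derive t 1 z D -> is_derive t 1 (fun s => z s i j) (D i j).
Proof.
move=> [dz <-]; have /derivable_mxP dzij := dz.
by apply: DeriveDef; [exact: dzij|rewrite derive_mx // mxE].
Qed.

Lemma within_continuous_entry (R : realType) (m n : nat) (D : set R) (z : R -> 'M[R]_(m, n)) i j :
  {within D, continuous z} -> {within D, continuous (fun s => z s i j)}.
Proof.
move=> zc s.
exact: (@continuous_comp (subspace D) 'M[R]_(m, n) R z (fun M => M i j) s (zc s)
  (coord_continuous (i := i) (j := j) (x := z s))).
Qed.

Lemma within_continuous_le (R : realType) (f : R -> R) (a b : R) : a <= b ->
  {within `[a, b], continuous f} -> exists2 C, 0 <= C & forall t, a <= t -> t <= b -> `|f t| <= C.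
Proof.
move=> ab fc.
have nc : {within `[a, b], continuous (fun t => `|f t|)}.
  move=> s.
  exact: (@continuous_comp (subspace `[a, b]) R R f (fun y => `|y|) s (fc s) (norm_continuous (x := f s))).
have [c _ cP] := EVT_max ab nc.
by exists `|f c| => // t at_ tb; apply: cP; rewrite in_itv /= at_.
Qed.

Lemma within_continuous_mx_le (R : realType) (m n : nat) (z : R -> 'M[R]_(m, n)) (a b : R) : a <= b ->
  {within `[a, b], continuous z} ->
  exists2 C, 0 <= C & forall t i j, a <= t -> t <= b -> `|z t i j| <= C.
Proof.
move=> ab zc.
have H (ij : 'I_m * 'I_n) : exists C, 0 <= C /\ forall t, a <= t -> t <= b -> `|z t ij.1 ij.2| <= C.
  by have [C C0 CP] := within_continuous_le ab (within_continuous_entry (i := ij.1) (j := ij.2) zc); exists C.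
have [C CP] := choice H.
exists (\sum_ij C ij); first by apply: sumr_ge0 => ij _; case: (CP ij).
move=> t i j at_ tb; rewrite (bigD1 (i, j)) //=.
apply: (le_trans (proj2 (CP (i, j)) t at_ tb)); rewrite lerDl.
by apply: sumr_ge0 => ij _; case: (CP ij).
Qed.

(** The mean value theorem is used twice: an entry of the defect is (t - s) times an entry of F (z c
    - z s), and every entry of z c - z s is in turn at most K B (c - s). The intermediate point
    depends on the entry, hence the entrywise bound assumed on F. *)
Lemma classical_solution_step (R : realType) (m n : nat) (F : 'M[R]_(m, n) -> 'M[R]_(m, n))
    (z0 : 'M[R]_(m, n)) (z : R -> 'M[R]_(m, n)) (K T : R) :
  classical_solution F z0 z -> 0 <= K -> 0 <= T ->
  (forall M M' : 'M[R]_(m, n), F (M - M') = F M - F M') ->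
  (forall (M : 'M[R]_(m, n)) (c : R), (forall i j, `|M i j| <= c) -> forall i j, `|F M i j| <= K * c) ->
  exists C, [/\ 0 <= C,
   forall s i j, 0 <= s -> s <= T -> `|z s i j| <= C &
   forall s t i j, 0 <= s -> s <= t -> t <= T ->
     `|(z t - z s - (t - s) *: F (z s)) i j| <= C * (t - s) ^+ 2].
Proof.
move=> [_ zc zd] K0 T0 FB FK.
have sub (s t : R) : 0 <= s -> s <= t -> `[s, t] `<=` (`[0, +oo[ : set R).
  move=> s0 st r /=; rewrite !in_itv /= andbT => /andP[sr _]; exact: le_trans sr.
have cs (s t : R) i j : 0 <= s -> s <= t -> {within `[s, t], continuous (fun s => z s i j)}.
  move=> s0 st; apply: within_continuous_entry.
  exact: continuous_subspaceW (sub _ _ s0 st) zc.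
have mvt (s t : R) i j : 0 <= s -> s <= t ->
    exists2 c, s <= c <= t & z t i j - z s i j = F (z c) i j * (t - s).
  move=> s0 st.
  have [|c] := MVT_segment st _ (cs s t i j s0 st) (df := fun r => F (z r) i j).
    move=> r; rewrite in_itv /= => /andP[sr _]; apply: is_derive_entry.
    apply: zd; exact: le_lt_trans sr.
  by rewrite in_itv /= => H1 H2; exists c.
have [B B0 zB] := within_continuous_mx_le T0 (continuous_subspaceW (sub _ _ (lexx _) T0) zc).
(* [B] bounds the trajectory on [0, T] and [K * (K * B)] bounds the quadratic error; the sum serves
   both purposes. *)
exists (B + K * (K * B)); split; first by rewrite addr_ge0 ?mulr_ge0.
  by move=> s i j s0 sT; rewrite (le_trans (zB _ _ _ _ _)) // lerDl !mulr_ge0.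
move=> s t i j s0 st tT; rewrite !mxE.
have [c /andP[sc ct] ->] := mvt s t i j s0 st.
have -> : F (z c) i j * (t - s) - (t - s) * F (z s) i j = F (z c - z s) i j * (t - s).
  by rewrite FB !mxE; ring.
have ts0 : 0 <= t - s by rewrite subr_ge0.
rewrite normrM (ger0_norm ts0) expr2 (mulrA _ (t - s)) ler_wpM2r //.
apply: (@le_trans _ _ (K * (K * B * (t - s)))); last first.
  by rewrite mulrA ler_wpM2r // lerDr.
apply: (FK _ _) => k l; rewrite !mxE.
have [d /andP[sd dc] ->] := mvt s c k l s0 sc.
have cs0 : 0 <= c - s by rewrite subr_ge0.
rewrite normrM (ger0_norm cs0) ler_pM //; last by rewrite lerD2r.
apply: FK => k' l'; apply: zB; first exact: le_trans sd.
by rewrite (le_trans dc) // (le_trans ct).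
Qed.

(** * Linearity and boundedness of the Lyapunov operator *)

Section LyapunovOp.
Variables (R : realType) (n m : nat) (A : 'M[R]_n) (N : 'I_m -> 'M[R]_n) (gamma : R).

Lemma lyapunov_opB M M' : lyapunov_op A N gamma (M - M') =
  lyapunov_op A N gamma M - lyapunov_op A N gamma M'.
Proof.
rewrite /lyapunov_op mulmxBr mulmxBl.
under eq_bigr do rewrite mulmxBr mulmxBl.
rewrite sumrB scalerBr.
move: (A *m M) (A *m M') (M *m _) (M' *m _) (_ *: _) (_ *: _) => a b c d e f.
by apply/matrixP => i j; rewrite !mxE; ring.
Qed.

Lemma mulmx_entry_le l p q (M : 'M[R]_(l, p)) (M' : 'M[R]_(p, q)) c c' :
  (forall i j, `|M i j| <= c) -> (forall i j, `|M' i j| <= c') ->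
  forall i j, `|(M *m M') i j| <= p%:R * c * c'.
Proof.
move=> Mc Mc' i j; rewrite mxE (le_trans (ler_norm_sum _ _ _)) //.
rewrite -mulrA mulr_natl -[X in _ <= _ *+ X]card_ord -sumr_const.
by apply: ler_sum => k _; rewrite normrM ler_pM.
Qed.

Lemma lyapunov_op_le : exists2 K, 0 <= K & forall (M : 'M[R]_n) (c : R), (forall i j, `|M i j| <= c) ->
  forall i j, `|lyapunov_op A N gamma M i j| <= K * c.
Proof.
have tr p q (B : 'M[R]_(p, q)) i j : `|B^T i j| <= mxabs B.
  by rewrite mxE entry_le_mxabs.
exists (n%:R * mxabs A + n%:R * mxabs A +
  `|gamma ^- 2| * \sum_k n%:R * (n%:R * mxabs (N k)) * mxabs (N k)).
  rewrite addr_ge0 ?mulr_ge0 ?addr_ge0 ?mulr_ge0 ?mxabs_ge0 //.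
  by apply: sumr_ge0 => k _; rewrite !mulr_ge0 ?mxabs_ge0.
move=> M c Mc i j; rewrite /lyapunov_op mxE [X in `|X + _|]mxE.
have s1 := mulmx_entry_le (entry_le_mxabs A) Mc i j.
have s2 := mulmx_entry_le Mc (tr _ _ A) i j.
have s3 : `|(gamma ^- 2 *: \sum_k N k *m M *m (N k)^T) i j| <=
   `|gamma ^- 2| * \sum_k n%:R * (n%:R * mxabs (N k)) * mxabs (N k) * c.
  rewrite mxE normrM ler_wpM2l // summxE (le_trans (ler_norm_sum _ _ _)) //.
  apply: ler_sum => k _.
  have := mulmx_entry_le (mulmx_entry_le (entry_le_mxabs (N k)) Mc) (tr _ _ (N k)) i j.
  by move/le_trans; apply; rewrite le_eqVlt; apply/orP; left; apply/eqP; ring.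
rewrite -mulr_suml in s3.
have t1 := ler_normD ((A *m M) i j) ((M *m A^T) i j).
have t2 := ler_normD ((A *m M) i j + (M *m A^T) i j) ((gamma ^- 2 *: \sum_k N k *m M *m (N k)^T) i j).
move: t1 t2 s1 s2 s3; lra.
Qed.

End LyapunovOp.

(** * Real-valued Lebesgue integrals over intervals *)

Section RealIntegral.
Context d (T : measurableType d) (R : realType) (mu : {measure set T -> \bar R}).
Implicit Types (D : set T) (f g : T -> R).

Lemma integrable_fctD D f g : measurable D -> mu.-integrable D (EFin \o f) ->
  mu.-integrable D (EFin \o g) -> mu.-integrable D (EFin \o (fun r => f r + g r)).
Proof. by move=> mD fi gi; exact: (integrableD mD fi gi). Qed.

Lemma integrable_fctZ D (a : R) f : measurable D -> mu.-integrable D (EFin \o f) ->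
  mu.-integrable D (EFin \o (fun r => a * f r)).
Proof. by move=> mD fi; exact: (integrableZl mD a fi). Qed.

Lemma integrable_fct_sum (I : finType) D (f : I -> T -> R) : measurable D ->
  (forall k, mu.-integrable D (EFin \o f k)) ->
  mu.-integrable D (EFin \o (fun r => \sum_k f k r)).
Proof.
move=> mD fi.
apply: (eq_integrable mD _ _ _ (integrable_sum mD (index_enum I) (P := xpredT) (fun k _ => fi k))).
by move=> r _; rewrite /= sumEFin.
Qed.

Lemma Rintegral_fct_sum (I : finType) D (f : I -> T -> R) : measurable D ->
  (forall k, mu.-integrable D (EFin \o f k)) ->
  \int[mu]_(r in D) (\sum_k f k r) = \sum_k \int[mu]_(r in D) f k r.
Proof.
move=> mD fi; rewrite /Rintegral.
under eq_integral do rewrite -sumEFin.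
rewrite (integral_sum mD fi).
have e k : (\int[mu]_(r in D) (EFin \o f k) r = (\int[mu]_(r in D) f k r)%:E)%E.
  by rewrite fineK //; apply: integrable_fin_num => //; exact: fi.
by rewrite (eq_bigr _ (fun k _ => e k)) sumEFin.
Qed.

End RealIntegral.

Section LebesgueInterval.
Variable R : realType.
Notation mu := (@lebesgue_measure R).
Implicit Types (f g : R -> R).

Lemma integrable_itv_cst (s t c : R) : mu.-integrable `]s, t] (EFin \o (fun=> c)).
Proof.
have h : mu.-integrable `[s, t] (EFin \o (fun=> c)).
  apply: continuous_compact_integrable; first exact: segment_compact.
  by move=> r; exact: cst_continuous.
by apply: integrableS h => //; exact: subset_itv_oc_cc.
Qed.

Lemma Rintegral_itv_cst (s t c : R) : s <= t -> \int[mu]_(r in `]s, t]) c = c * (t - s).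
Proof.
move=> st; rewrite Rintegral_cst //= lebesgue_measure_itv /= lte_fin.
by case: ltP => // ts; rewrite (_ : t = s) ?subrr //; apply/eqP; rewrite eq_le ts st.
Qed.

(** Cauchy-Schwarz against the constant 1, obtained by integrating the square of the deviation of f
    from its mean J / h. *)
Lemma sqr_Rintegral_le (s t : R) f : s <= t ->
  mu.-integrable `]s, t] (EFin \o f) ->
  mu.-integrable `]s, t] (EFin \o (fun r => f r ^+ 2)) ->
  (\int[mu]_(r in `]s, t]) f r) ^+ 2 <= (t - s) * \int[mu]_(r in `]s, t]) (f r ^+ 2).
Proof.
move=> st fi f2i.
have [ts|ts] := eqVneq t s.
  by rewrite ts subrr mul0r set_itvoc0 Rintegral_set0 expr0n.
have h0 : 0 < t - s by rewrite subr_gt0 lt_neqAle eq_sym ts.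
set J := \int[mu]_(r in _) f r; set J2 := \int[mu]_(r in _) _.
set h := t - s in h0 *.
have ci c := integrable_itv_cst s t c.
have : 0 <= \int[mu]_(r in `]s, t]) ((f r - J / h) ^+ 2).
  by apply: Rintegral_ge0 => r _; exact: sqr_ge0.
have -> : \int[mu]_(r in `]s, t]) ((f r - J / h) ^+ 2) =
   \int[mu]_(r in `]s, t]) (f r ^+ 2 + ((- (2 * (J / h))) * f r + (J / h) ^+ 2)).
  by congr fine; apply: eq_integral => r _; congr EFin; ring.
have l1 : mu.-integrable `]s, t] (EFin \o (fun r => (- (2 * (J / h))) * f r)).
  exact: integrable_fctZ.
rewrite RintegralD //; last exact: integrable_fctD.
rewrite RintegralD // RintegralZl // Rintegral_itv_cst // -/h -/J -/J2.
move=> pos; rewrite -subr_ge0.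
have -> : h * J2 - J ^+ 2 = h * (J2 + (- (2 * (J / h)) * J + (J / h) ^+ 2 * h)).
  by field; rewrite gt_eqF.
by rewrite pmulr_rge0.
Qed.

Lemma Rintegral_itv_nd (s t s' t' : R) f : s' <= s -> t <= t' -> (forall r, 0 <= f r) ->
  mu.-integrable `]s', t'] (EFin \o f) ->
  \int[mu]_(r in `]s, t]) f r <= \int[mu]_(r in `]s', t']) f r.
Proof.
move=> ss tt f0 fi.
have sub : `]s, t] `<=` `]s', t'].
  by move=> r /=; rewrite !in_itv /= => /andP[/(le_lt_trans ss) -> /le_trans -> //].
have fi' : mu.-integrable `]s, t] (EFin \o f) by apply: (@integrableS _ _ _ mu) fi => //; exact: sub.
rewrite /Rintegral fine_le ?integrable_fin_num //.
apply: ge0_subset_integral => //; first exact: measurable_int fi.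
by move=> r _; rewrite lee_fin.
Qed.

End LebesgueInterval.

(** * Increments, boundedness and measurability of the controlled state *)

Section BilinearSystem.
Variables (R : realType) (n m : nat) (A : 'M[R]_n) (N : 'I_m -> 'M[R]_n).
Notation mu := (@lebesgue_measure R).

Definition system_size : R := mxabs A + \sum_k mxabs (N k).

(** The summand 1 accounts for the drift [A *m x], so that a single factor dominates the whole
    right-hand side. *)
Definition control_size (u : R -> 'cV[R]_m) (r : R) : R := 1 + \sum_k `|u r k 0|.

Lemma control_size_ge0 u r : 0 <= control_size u r.
Proof. by rewrite addr_ge0 // sumr_ge0. Qed.

Lemma system_size_ge0 : 0 <= system_size.
Proof. by rewrite addr_ge0 ?mxabs_ge0 // sumr_ge0 // => k _; exact: mxabs_ge0. Qed.

Lemma mulmx_le (M : 'M[R]_n) (y : 'cV[R]_n) c : (forall i, `|y i 0| <= c) -> 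
  forall i, `|(M *m y) i 0| <= mxabs M * c.
Proof.
move=> yc i; have c0 : 0 <= c by exact: le_trans (yc i).
rewrite mxE (le_trans (ler_norm_sum _ _ _)) //.
apply: (@le_trans _ _ (\sum_j `|M i j| * c)).
  by apply: ler_sum => j _; rewrite normrM ler_wpM2l.
rewrite -mulr_suml ler_wpM2r // /mxabs [leRHS](bigD1 i) //= lerDl.
by apply: sumr_ge0 => k _; apply: sumr_ge0.
Qed.

Lemma bilinear_rhs_le u r (y : 'cV[R]_n) c : (forall i, `|y i 0| <= c) ->
  forall i, `|bilinear_rhs A N u r y i 0| <= system_size * c * control_size u r.
Proof.
move=> yc i; have c0 : 0 <= c by exact: le_trans (yc i).
rewrite /bilinear_rhs mxE summxE (le_trans (ler_normD _ _)) //.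
rewrite /system_size !mulrDl lerD //.
  rewrite (le_trans (mulmx_le _ yc i)) // ler_peMr ?mulr_ge0 ?mxabs_ge0 //.
  by rewrite lerDl sumr_ge0.
rewrite (le_trans (ler_norm_sum _ _ _)) // !mulr_suml; apply: ler_sum => k _.
rewrite mxE normrM mulrC ler_pM // ?mulmx_le //.
rewrite /control_size (bigD1 k) //= addrCA lerDl addr_ge0 //.
by rewrite sumr_ge0.
Qed.

Lemma bilinear_rhsB u r (y y' : 'cV[R]_n) :
  bilinear_rhs A N u r (y - y') = bilinear_rhs A N u r y - bilinear_rhs A N u r y'.
Proof.
rewrite /bilinear_rhs mulmxBr.
under eq_bigr do rewrite mulmxBr scalerBr.
by rewrite sumrB opprD addrACA.
Qed.

Variables (u : R -> 'cV[R]_m) (x0 : 'cV[R]_n) (x : R -> 'cV[R]_n).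
Hypothesis u_meas : forall k, measurable_fun (`[0, +oo[ : set R) (fun s => u s k 0).
Hypothesis u_int : mu.-integrable `[0, +oo[ (EFin \o (fun s => dotprod (u s) (u s))).
Hypothesis xsol : caratheodory_solution (bilinear_rhs A N u) x0 x.

Definition energy (t : R) : R := \int[mu]_(s in `[0, t]) dotprod (u s) (u s).

Lemma dotprod_ge0 k (y : 'cV[R]_k) : 0 <= dotprod y y.
Proof. by apply: sumr_ge0 => i _; rewrite -expr2 sqr_ge0. Qed.

Section Step.
Variables s t : R.
Hypotheses (s0 : 0 <= s) (st : s <= t).

Let subD : `]s, t] `<=` (`[0, +oo[ : set R).
Proof.
by move=> r /=; rewrite !in_itv /= andbT => /andP[sr _]; rewrite (le_trans s0) // ltW.
Qed.

Let sub0t : `[0, t] `<=` (`[0, +oo[ : set R).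
Proof. by move=> r /=; rewrite !in_itv /= andbT => /andP[]. Qed.

Lemma energyB : energy t - energy s = \int[mu]_(r in `]s, t]) dotprod (u r) (u r).
Proof.
by rewrite /energy Rintegral_itvB //; apply: (@integrableS _ _ _ mu) u_int => //; exact: sub0t.
Qed.

Let u2_int : mu.-integrable `]s, t] (EFin \o (fun r => dotprod (u r) (u r))).
Proof. by apply: (@integrableS _ _ _ mu) u_int => //; exact: subD. Qed.

Let uk_meas k : measurable_fun `]s, t] (fun r => u r k 0).
Proof. exact: measurable_funS subD (u_meas k). Qed.

Let sqr_le_dot r k : u r k 0 ^+ 2 <= dotprod (u r) (u r).
Proof.
rewrite /dotprod (bigD1 k) //= expr2 lerDl.
by apply: sumr_ge0 => i _; rewrite -expr2 sqr_ge0.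
Qed.

Let uk2_int k : mu.-integrable `]s, t] (EFin \o (fun r => u r k 0 ^+ 2)).
Proof.
apply: (le_integrable _ _ _ u2_int) => //.
  by apply/measurable_EFinP; apply: measurable_funX; exact: uk_meas.
move=> r _ /=; rewrite lee_fin (ger0_norm (sqr_ge0 _)).
by rewrite ger0_norm ?dotprod_ge0.
Qed.

(** On a bounded interval L^2 is contained in L^1, through |y| <= 1 + y^2. *)
Let uk_int k : mu.-integrable `]s, t] (EFin \o (fun r => u r k 0)).
Proof.
apply: (le_integrable _ _ _ (integrable_fctD _ (integrable_itv_cst s t 1) (uk2_int k))) => //.
  by apply/measurable_EFinP; exact: uk_meas.
move=> r _ /=; rewrite lee_fin [leRHS]ger0_norm ?addr_ge0 ?sqr_ge0 //.
have := sqr_ge0 (`|u r k 0| - 1); rewrite -[X in _ -> _ <= 1 + X]real_normK ?num_real //.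
have := normr_ge0 (u r k 0); nra.
Qed.

Let size_int : mu.-integrable `]s, t] (EFin \o control_size u).
Proof.
apply: integrable_fctD => //; first exact: integrable_itv_cst.
apply: (@integrable_fct_sum _ _ R mu 'I_m _ (fun k r => `|u r k 0|)) => // k.
by apply: integrable_norm; exact: uk_int.
Qed.

(** Cauchy-Schwarz with all weights 1; [m.+1] counts the m components of the control and the
    constant summand. *)
Let size_sqr_le r : control_size u r ^+ 2 <= m.+1%:R * (1 + dotprod (u r) (u r)).
Proof.
have := weighted_cauchy_schwarz (fun=> 1) (fun k => `|u r k 0|) 1 (@ltr01 R).
rewrite /control_size; under eq_bigr do rewrite mul1r.
move/le_trans; apply; rewrite invr1 !mul1r expr1n.
rewrite sumr_const card_ord -natr1 [1 + m%:R]addrC.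
under eq_bigr do rewrite real_normK ?num_real //.
by [].
Qed.

Let G2_int : mu.-integrable `]s, t]
  (EFin \o (fun r => m.+1%:R * (1 + dotprod (u r) (u r)))).
Proof.
apply: integrable_fctZ => //; apply: integrable_fctD => //.
exact: integrable_itv_cst.
Qed.

Let size2_int : mu.-integrable `]s, t] (EFin \o (fun r => control_size u r ^+ 2)).
Proof.
apply: (le_integrable _ _ _ G2_int) => //.
  apply/measurable_EFinP; apply: measurable_funX.
  by apply/measurable_EFinP; exact: measurable_int size_int.
move=> r _ /=; rewrite lee_fin (ger0_norm (sqr_ge0 _)) (le_trans (size_sqr_le r)) //.
exact: ler_norm.
Qed.

(** The bound is the step length times the increment of time plus energy, so the sum of such errors
    over a grid is of the order of the step length. *)
Lemma sqr_Rintegral_control_size_le :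
  (\int[mu]_(r in `]s, t]) control_size u r) ^+ 2 <=
    m.+1%:R * (t - s) * (t - s + (energy t - energy s)).
Proof.
rewrite (le_trans (sqr_Rintegral_le st size_int size2_int)) //.
rewrite -mulrA mulrCA ler_wpM2l ?subr_ge0 //.
have := le_Rintegral _ size2_int G2_int (fun r _ => size_sqr_le r).
move=> /(_ (measurable_itv _)) /le_trans; apply.
rewrite RintegralZl //; last exact: (integrable_fctD _ (integrable_itv_cst s t 1)).
rewrite RintegralD //; last exact: integrable_itv_cst.
by rewrite Rintegral_itv_cst // mul1r energyB.
Qed.

Lemma control_increment_le :
  \sum_k (\int[mu]_(r in `]s, t]) u r k 0) ^+ 2 <= (t - s) * (energy t - energy s).
Proof.
rewrite energyB /dotprod (@Rintegral_fct_sum _ _ R mu 'I_m _ (fun k r => u r k 0 * u r k 0)) //.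
by rewrite mulr_sumr; apply: ler_sum => k _; exact: sqr_Rintegral_le (uk_int k) (uk2_int k).
Qed.

Lemma solutionB i : x t i 0 - x s i 0 =
  \int[mu]_(r in `]s, t]) bilinear_rhs A N u r (x r) i 0.
Proof.
have t0 := le_trans s0 st.
have [It ->] := xsol t0; have [_ ->] := xsol s0.
by rewrite !mxE opprD addrACA subrr add0r Rintegral_itvB ?bnd_simp //; exact: It.
Qed.

Let rhs_int i : mu.-integrable `]s, t] (EFin \o (fun r => bilinear_rhs A N u r (x r) i 0)).
Proof.
have [It _] := xsol (le_trans s0 st).
apply: integrableS (It i) => // r /=; rewrite !in_itv /= => /andP[sr ->].
by rewrite (le_trans s0) // ltW.
Qed.

(** Freezing the state makes the integral of the right-hand side exactly the Euler increment, with
    the integrated controls in the role of the U_k. *)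
Lemma frozen_rhs_integral i (y : 'cV[R]_n) :
  mu.-integrable `]s, t] (EFin \o (fun r => bilinear_rhs A N u r y i 0)) /\
  \int[mu]_(r in `]s, t]) bilinear_rhs A N u r y i 0 =
  ((t - s) *: (A *m y) + \sum_k (\int[mu]_(r in `]s, t]) u r k 0) *: (N k *m y)) i 0.
Proof.
have e : (fun r => bilinear_rhs A N u r y i 0) =
   (fun r => (A *m y) i 0 + \sum_k (N k *m y) i 0 * u r k 0).
  apply/funext => r; rewrite /bilinear_rhs mxE summxE; congr (_ + _).
  by apply: eq_bigr => k _; rewrite mxE mulrC.
have ik k : mu.-integrable `]s, t] (EFin \o (fun r => (N k *m y) i 0 * u r k 0)).
  by apply: integrable_fctZ => //; exact: uk_int.
have is_ : mu.-integrable `]s, t] (EFin \o (fun r => \sum_k (N k *m y) i 0 * u r k 0)).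
  exact: (@integrable_fct_sum _ _ R mu 'I_m _ (fun k r => (N k *m y) i 0 * u r k 0)).
have ic := integrable_itv_cst s t ((A *m y) i 0).
rewrite e; split; first exact: integrable_fctD.
rewrite RintegralD // Rintegral_itv_cst //.
rewrite (@Rintegral_fct_sum _ _ R mu 'I_m _ (fun k r => (N k *m y) i 0 * u r k 0)) //.
rewrite [RHS]mxE summxE [X in _ = X + _]mxE mulrC; congr (_ + _).
by apply: eq_bigr => k _; rewrite RintegralZl ?[RHS]mxE 1?mulrC //; exact: uk_int.
Qed.

Variable C : R.
Hypothesis x_le : forall r i, 0 <= r -> r <= t -> `|x r i 0| <= C.

Lemma solution_increment_le r i : s <= r -> r <= t -> `|x r i 0 - x s i 0| <=
   system_size * C * \int[mu]_(r in `]s, t]) control_size u r.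
Proof.
move=> sr rt.
have C0 : 0 <= C by exact: le_trans (x_le i s0 st).
have sub : `]s, r] `<=` `]s, t].
  by move=> q /=; rewrite !in_itv /= => /andP[-> /le_trans ->].
have -> : x r i 0 - x s i 0 = \int[mu]_(q in `]s, r]) bilinear_rhs A N u q (x q) i 0.
  have r0 := le_trans s0 sr.
  have [It ->] := xsol r0; have [_ ->] := xsol s0.
  by rewrite !mxE opprD addrACA subrr add0r Rintegral_itvB ?bnd_simp //; exact: It.
have ri : mu.-integrable `]s, r] (EFin \o (fun q => bilinear_rhs A N u q (x q) i 0)).
  by apply: (@integrableS _ _ _ mu) (rhs_int i) => //; exact: sub.
have si : mu.-integrable `]s, r] (EFin \o control_size u).
  by apply: (@integrableS _ _ _ mu) size_int => //; exact: sub.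
rewrite (le_trans (le_normr_Rintegral _ ri)) //.
apply: (@le_trans _ _ (\int[mu]_(q in `]s, r]) (system_size * C * control_size u q))).
  apply: le_Rintegral => //.
  - exact: (integrable_norm ri).
  - exact: integrable_fctZ.
  - move=> q /=; rewrite in_itv /= => /andP[sq qr]; apply: bilinear_rhs_le => j.
    by apply: x_le; rewrite ?(le_trans s0) ?(le_trans qr) // ltW.
rewrite RintegralZl // ler_wpM2l ?mulr_ge0 ?system_size_ge0 //.
by apply: Rintegral_itv_nd => // q; exact: control_size_ge0.
Qed.

(** By linearity the defect is the integral of the right-hand side at x r - x s. That increment is
    itself at most a multiple of S, the integral of [control_size], so the defect is of order
    S^2. *)
Lemma solution_step_le i :
  `|(x t - (x s + (t - s) *: (A *m x s) +
     \sum_k (\int[mu]_(r in `]s, t]) u r k 0) *: (N k *m x s))) i 0| <=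
  system_size ^+ 2 * C * m.+1%:R * (t - s) * (t - s + (energy t - energy s)).
Proof.
have C0 : 0 <= C by exact: le_trans (x_le i s0 st).
have [fi fE] := frozen_rhs_integral i (x s).
set S := \int[mu]_(r in `]s, t]) control_size u r.
have S0 : 0 <= S by apply: Rintegral_ge0 => r _; exact: control_size_ge0.
have -> : (x t - (x s + (t - s) *: (A *m x s) +
     \sum_k (\int[mu]_(r in `]s, t]) u r k 0) *: (N k *m x s))) i 0 =
  \int[mu]_(r in `]s, t]) (bilinear_rhs A N u r (x r) i 0 - bilinear_rhs A N u r (x s) i 0).
  rewrite RintegralB // fE -solutionB.
  move: (\sum_k _) ((t - s) *: _) => a b; rewrite !mxE; ring.
have di : mu.-integrable `]s, t] (EFin \o (fun r =>
    bilinear_rhs A N u r (x r) i 0 - bilinear_rhs A N u r (x s) i 0)).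
  exact: (integrableB _ (rhs_int i) fi).
have ss := system_size_ge0.
rewrite (le_trans (le_normr_Rintegral _ di)) //.
apply: (@le_trans _ _ (\int[mu]_(q in `]s, t]) (system_size * (system_size * C * S) * control_size u q))).
  apply: le_Rintegral => //.
  - exact: (integrable_norm di).
  - exact: integrable_fctZ.
  - move=> q /=; rewrite in_itv /= => /andP[sq qr].
    have -> : bilinear_rhs A N u q (x q) i 0 - bilinear_rhs A N u q (x s) i 0 =
       bilinear_rhs A N u q (x q - x s) i 0 by rewrite bilinear_rhsB !mxE.
    by apply: bilinear_rhs_le => j; rewrite !mxE solution_increment_le // ltW.
rewrite RintegralZl // -/S.
have -> : system_size * (system_size * C * S) * S = system_size ^+ 2 * C * S ^+ 2 by ring.
rewrite -!(mulrA (system_size ^+ 2 * C)) ler_wpM2l //.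
  by rewrite mulr_ge0 // sqr_ge0.
by rewrite sqr_Rintegral_control_size_le.
Qed.

End Step.

Lemma energy_nd s t : 0 <= s -> s <= t -> energy s <= energy t.
Proof.
move=> s0 st; rewrite -subr_ge0 energyB //.
by apply: Rintegral_ge0 => r _; exact: dotprod_ge0.
Qed.

Lemma energy0 : energy 0 = 0.
Proof. by rewrite /energy set_itv1 Rintegral_set1. Qed.

Lemma caratheodory_solution_bounded T : 0 <= T ->
  exists2 C, 0 <= C & forall r i, 0 <= r -> r <= T -> `|x r i 0| <= C.
Proof.
move=> T0; have [It _] := xsol T0.
pose B i := `|x0 i 0| + \int[mu]_(r in `[0, T]) `|bilinear_rhs A N u r (x r) i 0|.
have B0 i : 0 <= B i by rewrite addr_ge0 // Rintegral_ge0.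
exists (\sum_i B i); first exact: sumr_ge0.
move=> r i r0 rT; rewrite (bigD1 i) //=.
apply: (@le_trans _ _ (B i)); last by rewrite lerDl sumr_ge0.
have [Ir ->] := xsol r0; rewrite !mxE (le_trans (ler_normD _ _)) // lerD2l.
rewrite (le_trans (le_normr_Rintegral _ (Ir i))) //.
have nI := integrable_norm (It i); have nr := integrable_norm (Ir i).
rewrite /Rintegral fine_le ?integrable_fin_num //.
apply: ge0_subset_integral => //; first exact: measurable_int nI.
by move=> q /=; rewrite !in_itv /= => /andP[-> /le_trans ->].
Qed.

(** On each [0, k] the state is a constant plus an integral with variable endpoint, hence continuous
    there; countably many such intervals cover the half-line. *)
Lemma caratheodory_solution_measurable i :
  measurable_fun (`[0, +oo[ : set R) (fun t => x t i 0).
Proof.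
have -> : (`[0, +oo[%classic : set R) = \bigcup_(k : nat) `[0, (k%:R : R)]%classic.
  apply/seteqP; split => [r /=|r [k _] /=]; rewrite !in_itv /= ?andbT => r0; last by case/andP: r0.
  by exists (Num.trunc r).+1 => //=; rewrite in_itv /= r0 ltW // truncnS_gt.
apply/measurable_fun_bigcup => // k.
have k0 : 0 <= k%:R :> R by [].
have [Ik _] := xsol k0.
have c := parameterized_integral_continuous k0 (Ik i).
have mc : measurable_fun (`[0, k%:R]%classic : set R)
    (fun t => \int[mu]_(r in `[0, t]) bilinear_rhs A N u r (x r) i 0).
  exact: subspace_continuous_measurable_fun.
have mf := measurable_funD (measurable_cst (x0 i 0)) mc.
apply: eq_measurable_fun mf => t; rewrite inE /= in_itv /= => /andP[t0 _].
by have [_ ->] := xsol t0; rewrite !mxE.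
Qed.

End BilinearSystem.

(** * Exponential decay of a forced planar rotation *)

Section ScalarDecay.
Variable R : realType.

Lemma is_derive_expRM (k t : R) :
  is_derive t 1 (fun s => expR (k * s)) (k * expR (k * t)).
Proof.
have D := is_derive1_comp (is_derive_expR (k * t)) (is_deriveZ k (is_derive_id t 1)).
by apply: (is_derive_eq D); rewrite [_ *: _]mulr1 mulrC.
Qed.

Lemma expRM_continuous (k : R) (D : set R) : {within D, continuous (fun s : R => expR (k * s))}.
Proof.
apply: continuous_subspaceT => t.
have [dt _] := is_derive_expRM k t.
exact/differentiable_continuous/derivable1_diffP.
Qed.

Lemma within_continuousD (D : set R) (f g : R -> R) : {within D, continuous f} ->
  {within D, continuous g} -> {within D, continuous (fun s => f s + g s)}.
Proof. by move=> cf cg s; exact: (@continuousD _ _ _ _ _ s (cf s) (cg s)). Qed.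

Lemma within_continuousM (D : set R) (f g : R -> R) : {within D, continuous f} ->
  {within D, continuous g} -> {within D, continuous (fun s => f s * g s)}.
Proof. by move=> cf cg s; exact: (@continuousM _ _ _ _ s (cf s) (cg s)). Qed.

Lemma within_continuousZ (D : set R) (k : R) (f : R -> R) : {within D, continuous f} ->
  {within D, continuous (fun s => k * f s)}.
Proof.
by move=> cf; apply: within_continuousM => //; apply: continuous_subspaceT => s; exact: cst_continuous.
Qed.

Lemma within_continuous_sum (D : set R) (I : Type) (r : seq I) (f : I -> R -> R) :
  (forall i, {within D, continuous (f i)}) -> {within D, continuous (fun s => \sum_(i <- r) f i s)}.
Proof.
move=> cf; elim: r => [|i r IH].
  have -> : (fun s => \sum_(i <- [::]) f i s) = cst 0 by apply/funext => s; rewrite big_nil.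
  by apply: continuous_subspaceT => s; exact: cst_continuous.
have -> : (fun s => \sum_(j <- i :: r) f j s) = (fun s => f i s + \sum_(j <- r) f j s).
  by apply/funext => s; rewrite big_cons.
exact: within_continuousD.
Qed.

(* With d = -(c + alpha), the function
   e^{(2c+d)t} (a^2 + b^2) - (2C^2/d^2) e^{dt} is nonincreasing. *)
Lemma forced_rotation_decay (a b g h : R -> R) (alpha beta c C : R) :
  alpha < - c -> 
  {within `[0, +oo[, continuous a} -> {within `[0, +oo[, continuous b} ->
  (forall t : R, 0 < t -> is_derive t 1 a (alpha * a t - beta * b t + g t)) ->
  (forall t : R, 0 < t -> is_derive t 1 b (beta * a t + alpha * b t + h t)) ->
  (forall t, 0 <= t -> `|g t| <= C * expR (- c * t) /\ `|h t| <= C * expR (- c * t)) ->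
  exists C', forall t, 0 <= t ->
    `|a t| <= C' * expR (- c * t) /\ `|b t| <= C' * expR (- c * t).
Proof.
move=> ac ca cb da db gh.
have [d d0 dE] : exists2 d, 0 < d & alpha = - c - d by exists (- (c + alpha)); lra.
pose k := 2 * c + d.
pose q := 2 * C ^+ 2 / d ^+ 2.
pose psi (s : R) := expR (k * s) * (a s * a s + b s * b s) - q * expR (d * s).
pose B := a 0 ^+ 2 + b 0 ^+ 2 + q.
have q0 : 0 <= q by apply: divr_ge0 (sqr_ge0 d); exact: mulr_ge0 (sqr_ge0 C).
have B0 : 0 <= B by rewrite addr_ge0 // addr_ge0 // sqr_ge0.
have key t : 0 <= t -> a t ^+ 2 + b t ^+ 2 <= B * expR (- c * t) ^+ 2.
  move=> t0.
  have sub : `[0, t] `<=` (`[0, +oo[ : set R).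
    by move=> r /=; rewrite !in_itv /= andbT => /andP[].
  have ca' := continuous_subspaceW sub ca; have cb' := continuous_subspaceW sub cb.
  have cpsi : {within `[0, t], continuous psi}.
    have e : psi = (fun s => expR (k * s) * (a s * a s + b s * b s) + - q * expR (d * s)).
      by apply/funext => s; rewrite /psi (mulNr q).
    rewrite e; apply: within_continuousD; last first.
      by apply: within_continuousZ; apply: expRM_continuous.
    apply: within_continuousM; first exact: expRM_continuous.
    by apply: within_continuousD; apply: within_continuousM.
  have [|s] := MVT_segment t0 (f := psi) (df := fun s =>
      expR (k * s) * (k * (a s * a s + b s * b s) +
        2 * (alpha * (a s ^+ 2 + b s ^+ 2) + a s * g s + b s * h s)) - q * (d * expR (d * s))) _ cpsi.
    move=> s; rewrite in_itv /= => /andP[s0 _].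
    have D1 := is_deriveD (is_deriveM (da s s0) (da s s0)) (is_deriveM (db s s0) (db s s0)).
    have D2 := is_deriveM (is_derive_expRM k s) D1.
    have D := is_deriveB D2 (is_deriveZ q (is_derive_expRM d s)).
    apply: (is_derive_eq (f := psi) D).
    by rewrite !fctE -![_ *: _]/(_ * _) /=; ring.
  rewrite in_itv /= => /andP[s0 _] psiE.
  have [gs hs] := gh s s0.
  have e2 : expR (k * s) = expR (d * s) * expR (c * s) ^+ 2.
    by rewrite -expRM_natl -expRD; congr expR; rewrite /k; ring.
  have ec : expR (c * s) * expR (- c * s) = 1.
    by rewrite -expRD mulNr subrr expR0.
  have b2 y : `|y| <= C * expR (- c * s) -> expR (c * s) ^+ 2 * y ^+ 2 <= C ^+ 2.
    move=> yC; have : `|expR (c * s) * y| <= C.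
      rewrite normrM gtr0_norm ?expR_gt0 // (le_trans (ler_wpM2l (expR_ge0 _) yC)) //.
      by rewrite mulrCA ec mulr1.
    by move=> H; rewrite -exprMn -[leLHS]real_normK ?num_real // ler_sqr ?nnegrE // (le_trans _ H).
  have g2 := b2 _ gs; have h2 := b2 _ hs.
  have neg : expR (k * s) * (k * (a s * a s + b s * b s) +
        2 * (alpha * (a s ^+ 2 + b s ^+ 2) + a s * g s + b s * h s)) - q * (d * expR (d * s)) <= 0.
    rewrite e2.
    set X := expR (c * s) in ec g2 h2 *; set Y := expR (d * s).
    have Y0 : 0 <= Y by exact: expR_ge0.
    (* The terms in [beta] have cancelled in the derivative of a^2 + b^2, and k + 2 alpha = - d.
       Completing the squares in d a - g and d b - h leaves g^2 + h^2, which the term in [q]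
       absorbs. *)
    have -> : Y * X ^+ 2 * (k * (a s * a s + b s * b s) +
        2 * (alpha * (a s ^+ 2 + b s ^+ 2) + a s * g s + b s * h s)) - q * (d * Y) =
      - (Y * (d^-1 * (X ^+ 2 * (d * a s - g s) ^+ 2 + X ^+ 2 * (d * b s - h s) ^+ 2 +
          (C ^+ 2 - X ^+ 2 * g s ^+ 2) + (C ^+ 2 - X ^+ 2 * h s ^+ 2)))).
      rewrite dE /k /q; field; exact: lt0r_neq0.
    rewrite oppr_le0; apply: mulr_ge0 => //; apply: mulr_ge0; first by rewrite invr_ge0 ltW.
    by apply: addr_ge0; [apply: addr_ge0; [apply: addr_ge0; apply: mulr_ge0; exact: sqr_ge0|]|];
      rewrite subr_ge0.
  have : psi t <= psi 0.
    by rewrite -subr_le0 psiE subr0 mulr_le0_ge0.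
  rewrite /psi !mulr0 expR0 mul1r mulr1 -!expr2 => le_psi.
  have et : expR (k * t) * expR (- c * t) ^+ 2 = expR (d * t).
    by rewrite -expRM_natl -expRD; congr expR; rewrite /k; ring.
  have ek : 0 < expR (k * t) by exact: expR_gt0.
  rewrite -(ler_pM2l ek) mulrCA et.
  have e1 : 1 <= expR (d * t) by rewrite -expR0 ler_expR mulr_ge0 // ltW.
  have s1 := sqr_ge0 (a 0); have s2 := sqr_ge0 (b 0).
  rewrite /B; nra.
exists (Num.sqrt B) => t t0.
have comp (y : R) : y ^+ 2 <= B * expR (- c * t) ^+ 2 -> `|y| <= Num.sqrt B * expR (- c * t).
  move=> yB; rewrite -ler_sqr ?nnegrE ?mulr_ge0 ?sqrtr_ge0 ?expR_ge0 //.
  by rewrite real_normK ?num_real // exprMn sqr_sqrtr.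
have K := key t t0; have s1 := sqr_ge0 (a t); have s2 := sqr_ge0 (b t).
by split; apply: comp; lra.
Qed.

End ScalarDecay.

(** * Decay of linear flows annihilated by a product of factors *)

Section VectorDecay.
Variables (R : realType) (n : nat) (M : 'M[R]_n).

Definition smooth_entries (a da : R -> 'cV[R]_n) : Prop :=
  (forall i, {within `[0, +oo[, continuous (fun t => a t i 0)}) /\
  (forall i (t : R), 0 < t -> is_derive t 1 (fun s => a s i 0) (da t i 0)).

Lemma smooth_entries_comb (B : 'M[R]_n) (k : R) (a b da db : R -> 'cV[R]_n) :
  smooth_entries a da -> smooth_entries b db ->
  smooth_entries (fun t => B *m a t + k *: b t) (fun t => B *m da t + k *: db t).
Proof.
move=> [ca Da] [cb Db].
have e (v w : R -> 'cV[R]_n) i : (fun t => (B *m v t + k *: w t) i 0) =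
    (\sum_(j < n) (B i j \*: (fun t => v t j 0))) + (k \*: (fun t => w t i 0)).
  by apply/funext => t; rewrite !mxE /= !fctE fct_sumE.
split=> i.
  have -> : (fun t => (B *m a t + k *: b t) i 0) =
      (fun t => \sum_(j < n) B i j * a t j 0 + k * b t i 0).
    by apply/funext => t; rewrite !mxE.
  apply: within_continuousD; last exact: within_continuousZ.
  by apply: within_continuous_sum => j; exact: within_continuousZ.
move=> t t0; rewrite e.
have D1 := is_derive_sum (fun j => is_deriveZ (B i j) (Da j t t0)).
have D := is_deriveD D1 (is_deriveZ k (Db i t t0)).
by apply: (is_derive_eq D); rewrite !mxE.
Qed.

(* Applying prod_(z <- r) (M - z) to the complex vector a + i b, in real terms. *)
Fixpoint annihilates (r : seq R[i]) (a b : 'cV[R]_n) : Prop :=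
  if r is z :: r' then
    annihilates r' ((M - (complex.Re z)%:M) *m a + complex.Im z *: b)
                   ((M - (complex.Re z)%:M) *m b + (- complex.Im z) *: a)
  else a = 0 /\ b = 0.

(** Since M commutes with M - z, the vector (M - z)(a + ib) solves the same equation and decays by
    induction. Its real and imaginary parts are the forcing terms of the planar system satisfied by
    each pair of entries of a and b. *)
Lemma annihilated_decay (c : R) (r : seq R[i]) (a b : R -> 'cV[R]_n) :
  (forall z, z \in r -> complex.Re z < - c) ->
  smooth_entries a (fun t => M *m a t) -> smooth_entries b (fun t => M *m b t) ->
  (forall t, 0 <= t -> annihilates r (a t) (b t)) ->
  exists C, forall t i, 0 <= t ->
    `|a t i 0| <= C * expR (- c * t) /\ `|b t i 0| <= C * expR (- c * t).
Proof.
elim: r a b => [|z r IH] a b rc sa sb ann.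
  exists 0 => t i t0; have [-> ->] := ann t t0.
  by rewrite mxE normr0 mul0r.
set B := M - (complex.Re z)%:M.
pose a2 t := B *m a t + complex.Im z *: b t.
pose b2 t := B *m b t + (- complex.Im z) *: a t.
have comm : B *m M = M *m B by rewrite /B mulmxBl mulmxBr scalar_mxC.
have comb (k : R) (v w : 'cV[R]_n) : B *m (M *m v) + k *: (M *m w) = M *m (B *m v + k *: w).
  by rewrite mulmxDr !mulmxA comm scalemxAr.
have s2 k v w : smooth_entries v (fun t => M *m v t) -> smooth_entries w (fun t => M *m w t) ->
    smooth_entries (fun t => B *m v t + k *: w t) (fun t => M *m (B *m v t + k *: w t)).
  move=> sv sw; have [c1 c2] := smooth_entries_comb B k sv sw.
  by split => // i t t0; rewrite -comb; exact: c2.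
have [||||C HC] := IH a2 b2.
- by move=> y yr; apply: rc; rewrite in_cons yr orbT.
- exact: s2.
- exact: s2.
- by move=> t t0; exact: ann.
have rz : complex.Re z < - c by apply: rc; rewrite mem_head.
have H (i : 'I_n) : exists C', forall t, 0 <= t ->
    `|a t i 0| <= C' * expR (- c * t) /\ `|b t i 0| <= C' * expR (- c * t).
  have F := @forced_rotation_decay R (fun t => a t i 0) (fun t => b t i 0)
    (fun t => a2 t i 0) (fun t => b2 t i 0) (complex.Re z) (complex.Im z) c C rz
    (sa.1 i) (sb.1 i).
  apply: F.
  - move=> t t0; apply: (is_derive_eq (sa.2 i t t0)).
    rewrite /a2 /B mulmxBl mul_scalar_mx.
    move: (M *m a t) => v; rewrite !mxE; ring.
  - move=> t t0; apply: (is_derive_eq (sb.2 i t t0)).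
    rewrite /b2 /B mulmxBl mul_scalar_mx.
    move: (M *m b t) => v; rewrite !mxE; ring.
  - by move=> t t0; exact: HC.
have [C' C'P] := choice H.
exists (\sum_i `|C' i|) => t i t0; have [h1 h2] := C'P i t t0.
have le : C' i * expR (- c * t) <= (\sum_i `|C' i|) * expR (- c * t).
  rewrite ler_wpM2r ?expR_ge0 // (bigD1 i) //=.
  by rewrite (le_trans (ler_norm _)) // lerDl sumr_ge0.
by split; [apply: le_trans h1 le|apply: le_trans h2 le].
Qed.

End VectorDecay.

(** * From the spectrum to decay, by Cayley-Hamilton *)

Section HurwitzDecay.
Variable R : realType.
Local Notation C := R[i].

Lemma spectrum_margin (r : seq C) : (forall z, z \in r -> complex.Re z < 0) ->
  exists2 c : R, 0 < c & forall z, z \in r -> complex.Re z < - c.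
Proof.
elim: r => [|z r IH] rP; first by exists 1.
have [|c c0 cP] := IH; first by move=> y yr; apply: rP; rewrite in_cons yr orbT.
have zP : complex.Re z < 0 by apply: rP; rewrite mem_head.
(* Halving makes the inequality at z strict. *)
exists (Num.min c (- complex.Re z / 2)).
  by rewrite lt_min c0 divr_gt0 // oppr_gt0.
move=> y; rewrite in_cons => /predU1P[->|yr].
  rewrite ltrNr gt_min; apply/orP; right; lra.
by rewrite ltrNr gt_min ltrNr cP.
Qed.

Definition complexify n (a b : 'cV[R]_n) : 'cV[C]_n := \col_i (a i 0 +i* b i 0)%C.

Lemma complexify_mul n (M : 'M[R]_n) (a b : 'cV[R]_n) :
  complexify (M *m a) (M *m b) = map_mx (real_complex R) M *m complexify a b.
Proof.
apply/colP => i; rewrite !mxE.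
under [RHS]eq_bigr do rewrite !mxE.
elim/big_ind3 : _ => //; last first.
  by move=> j _; rewrite /GRing.mul /= !mul0r subr0 addr0.
by move=> x1 x2 x3 y1 y2 y3 <- <-.
Qed.

Lemma complexify_step n (M : 'M[R]_n) (z : C) (a b : 'cV[R]_n) :
  complexify ((M - (complex.Re z)%:M) *m a + complex.Im z *: b)
             ((M - (complex.Re z)%:M) *m b + (- complex.Im z) *: a) =
  (map_mx (real_complex R) M - z%:M) *m complexify a b.
Proof.
rewrite [RHS]mulmxBl -complexify_mul !mulmxBl !mul_scalar_mx.
apply/colP => i; rewrite !mxE.
move: ((M *m a) i 0) ((M *m b) i 0) (a i 0) (b i 0) => p q s t.
case: z => x y; apply/eqP; rewrite eq_complex /=; apply/andP; split; apply/eqP; ring.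
Qed.

Lemma annihilates_prod n (M : 'M[R]_n.+1) (r : seq C) (a b : 'cV[R]_n.+1) :
  horner_mx (map_mx (real_complex R) M) (\prod_(z <- r) ('X - z%:P)) *m complexify a b = 0 ->
  annihilates M r a b.
Proof.
elim: r a b => [|z r IH] a b /=.
  rewrite big_nil rmorph1 mul1mx => /colP ab0.
  by split; apply/colP => i; have := ab0 i; rewrite !mxE => -[].
(* Commuting the factors puts the head of the list on the right, where it acts first, as in
   [annihilates]. *)
rewrite big_cons mulrC rmorphM /= -mulmxA rmorphB /= horner_mx_X horner_mx_C.
by rewrite -complexify_step => /IH.
Qed.

Lemma hurwitz_decay n (M : 'M[R]_n) (y : R -> 'cV[R]_n) : hurwitz M ->
  smooth_entries y (fun t => M *m y t) ->
  exists K c : R, 0 < c /\ forall t i, 0 <= t -> `|y t i 0| <= K * expR (- c * t).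
Proof.
case: n M y => [|n] M y hM sy.
  by exists 0, 1; split => // t [].
have [r rE] := closed_field_poly_normal (char_poly (map_mx (real_complex R) M)).
rewrite (monicP (char_poly_monic _)) scale1r in rE.
have [|c c0 cP] := @spectrum_margin r.
  move=> z zr; apply: hM; rewrite /spectrum /= eigenvalue_root_char rE.
  by rewrite root_prod_XsubC.
(* The real solution is treated as a complex one whose imaginary part is the zero solution. *)
have sy0 : smooth_entries (fun _ : R => 0 : 'cV[R]_n.+1) (fun=> M *m 0).
  split=> i.
    have -> : (fun _ : R => (0 : 'cV[R]_n.+1) i 0) = cst 0 by apply/funext => t; rewrite mxE.
    by apply: continuous_subspaceT => t; exact: cst_continuous.
  move=> t t0; rewrite mulmx0 mxE.
  exact: is_derive_cst.
have [|K HK] := annihilated_decay cP sy sy0.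
  move=> t t0; apply: annihilates_prod.
  by rewrite -rE Cayley_Hamilton mul0mx.
by exists K, c; split => // t i t0; have [] := HK t i t0.
Qed.

End HurwitzDecay.

(** * Vectorization of the Lyapunov equation and integrability of its solution *)

Section Vectorization.
Variable R : realType.

(** The index pairing is that of [*t], so that B (x) D acts on vectorized matrices as Z -> B Z
    D^T. *)
Definition vec n (Z : 'M[R]_n) : 'cV[R]_(n * n) :=
  \col_k Z (mxtens_unindex k).1 (mxtens_unindex k).2.

Lemma tensmx_vec n (B D Z : 'M[R]_n) : (B *t D) *m vec Z = vec (B *m Z *m D^T).
Proof.
apply/colP => k; case: (mxtens_indexP k) => i j; rewrite !mxE mxtens_indexK /=.
rewrite (reindex (@mxtens_index n n)) /=; last first.
  exists (@mxtens_unindex n n) => x _; [exact: mxtens_indexK|exact: mxtens_unindexK].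
transitivity (\sum_p \sum_q B i p * D j q * Z p q).
  rewrite pair_bigA /=; apply: eq_bigr => -[p q] _.
  by rewrite tensmxE mxE mxtens_indexK.
rewrite exchange_big /=; apply: eq_bigr => q _; rewrite !mxE mulr_suml.
by apply: eq_bigr => p _; ring.
Qed.

Lemma lyapunov_kron_vec n m (A : 'M[R]_n) (N : 'I_m -> 'M[R]_n) gamma Z :
  lyapunov_kron A N gamma *m vec Z = vec (lyapunov_op A N gamma Z).
Proof.
have vecD (Z1 Z2 : 'M[R]_n) : vec (Z1 + Z2) = vec Z1 + vec Z2.
  by apply/colP => k; rewrite !mxE.
have vecZ k (Z1 : 'M[R]_n) : vec (k *: Z1) = k *: vec Z1.
  by apply/colP => l; rewrite !mxE.
have vec0 : vec (0 : 'M[R]_n) = 0 by apply/colP => k; rewrite !mxE.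
rewrite /lyapunov_kron /lyapunov_op !mulmxDl -scalemxAl mulmx_suml !tensmx_vec !vecD vecZ.
rewrite trmx1 mulmx1 mul1mx (big_morph _ vecD vec0).
by congr (_ + _ *: _); apply: eq_bigr => k _; rewrite tensmx_vec.
Qed.

Lemma classical_solution_decay n m (A : 'M[R]_n) (N : 'I_m -> 'M[R]_n) gamma Z0 Z :
  hurwitz (lyapunov_kron A N gamma) -> classical_solution (lyapunov_op A N gamma) Z0 Z ->
  exists K c : R, 0 < c /\ forall t i j, 0 <= t -> `|Z t i j| <= K * expR (- c * t).
Proof.
move=> hK [_ Zc Zd].
have [|K [c [c0 H]]] := hurwitz_decay (y := fun t => vec (Z t)) hK.
  split=> k.
    have -> : (fun t => vec (Z t) k 0) =
        (fun t => Z t (mxtens_unindex k).1 (mxtens_unindex k).2).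
      by apply/funext => t; rewrite mxE.
    exact: within_continuous_entry.
  move=> t t0; rewrite lyapunov_kron_vec mxE.
  have -> : (fun t => vec (Z t) k 0) =
      (fun t => Z t (mxtens_unindex k).1 (mxtens_unindex k).2).
    by apply/funext => s; rewrite mxE.
  exact: is_derive_entry (Zd t t0).
exists K, c; split => // t i j t0.
by have := H t (mxtens_index (i, j)) t0; rewrite mxE mxtens_indexK.
Qed.

(** Up to the factor c this is the density of the exponential distribution, whose total mass is
    1. *)
Lemma integrable_expRN (c : R) : 0 < c ->
  lebesgue_measure.-integrable (`[0, +oo[ : set R) (EFin \o (fun t => expR (- c * t))).
Proof.
move=> c0.
have iT : lebesgue_measure.-integrable [set: R] (EFin \o exponential_pdf c).
  apply/integrableP; split.
    by apply/measurable_EFinP; exact: measurable_exponential_pdf.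
  under eq_integral do rewrite /= ger0_norm ?exponential_pdf_ge0 ?(ltW c0) //.
  by rewrite integral_exponential_pdf // ltry.
have i0 : lebesgue_measure.-integrable (`[0, +oo[ : set R) (EFin \o exponential_pdf c).
  by apply: integrableS iT.
have iZ : lebesgue_measure.-integrable (`[0, +oo[ : set R)
    (EFin \o (fun t => c^-1 * exponential_pdf c t)) by exact: integrable_fctZ.
apply: eq_integrable iZ => // t; rewrite inE /= in_itv /= andbT => t0.
by rewrite exponential_pdfE // mulrA mulVf ?mul1r // gt_eqF.
Qed.

Lemma integrable_of_decay (f : R -> R) (K c : R) : 0 < c ->
  {within `[0, +oo[, continuous f} ->
  (forall t, 0 <= t -> `|f t| <= K * expR (- c * t)) ->
  lebesgue_measure.-integrable (`[0, +oo[ : set R) (EFin \o f).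
Proof.
move=> c0 fc fK.
have eI : lebesgue_measure.-integrable (`[0, +oo[ : set R) (EFin \o (fun t => K * expR (- c * t))).
  by apply: integrable_fctZ => //; exact: integrable_expRN.
apply: (le_integrable _ _ _ eI) => //.
  by apply/measurable_EFinP; exact: subspace_continuous_measurable_fun.
move=> t /=; rewrite in_itv /= andbT => t0; rewrite lee_fin.
by rewrite (le_trans (fK t t0)) // ler_norm.
Qed.

End Vectorization.

(** * Active controls, initial data and the Gramian *)

Section EnergyBounds.
Variable R : realType.
Notation mu := (@lebesgue_measure R).

Lemma sqr_norm2 k (y : 'cV[R]_k) : norm2 y ^+ 2 = dotprod y y.
Proof. by rewrite sqr_sqrtr // dotprod_ge0. Qed.

(** A control is changed only where its matrix [N k] is 0. The state is thus also driven by u^0,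
    which is why only the energy of u^0 enters the estimate. *)
Lemma active_bilinear_rhs n m (A : 'M[R]_n) (N : 'I_m -> 'M[R]_n) (u : R -> 'cV[R]_m) :
  bilinear_rhs A N (active_control N u) = bilinear_rhs A N u.
Proof.
apply/funext => t; apply/funext => y; rewrite /bilinear_rhs; congr (_ + _).
apply: eq_bigr => k _; rewrite mxE.
by case: eqP => // ->; rewrite mul0mx !scaler0.
Qed.

Lemma in_L2_integrable m (u : R -> 'cV[R]_m) : in_L2 u ->
  mu.-integrable (`[0, +oo[ : set R) (EFin \o (fun s => dotprod (u s) (u s))).
Proof.
move=> [um uL]; apply/integrableP; split.
  apply/measurable_EFinP; rewrite /dotprod.
  apply: measurable_sum => k.
  by apply: measurable_funM; exact: um.
under eq_integral => s _.
  rewrite /= ger0_norm ?dotprod_ge0 // -sqr_norm2; over.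
by apply: lty_poweRy uL; rewrite invr_eq0.
Qed.

Lemma active_integrable n m (N : 'I_m -> 'M[R]_n) (u : R -> 'cV[R]_m) : in_L2 u ->
  (forall k, measurable_fun (`[0, +oo[ : set R) (fun s => active_control N u s k 0)) /\
  mu.-integrable (`[0, +oo[ : set R)
    (EFin \o (fun s => dotprod (active_control N u s) (active_control N u s))).
Proof.
move=> uL; have uI := in_L2_integrable uL.
have wm k : measurable_fun (`[0, +oo[ : set R) (fun s => active_control N u s k 0).
  have -> : (fun s => active_control N u s k 0) = (if N k == 0 then cst 0 else fun s => u s k 0).
    by apply/funext => s; rewrite mxE; case: ifP.
  by case: ifP => _; [exact: measurable_cst|exact: uL.1].
split=> //; apply: (le_integrable _ _ _ uI) => //.
  apply/measurable_EFinP; rewrite /dotprod.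
  apply: measurable_sum => k.
  by apply: measurable_funM; exact: wm.
move=> s _ /=; rewrite lee_fin !ger0_norm ?dotprod_ge0 //.
apply: ler_sum => k _; rewrite mxE; case: ifP => // _.
by rewrite mul0r -expr2 sqr_ge0.
Qed.

(** Cauchy-Schwarz for X0^T p and v0; this is the comparison at time 0. *)
Lemma dotprod_gramian_factor n q (X0 : 'M[R]_(n, q)) (v0 : 'cV[R]_q) (p : 'cV[R]_n) :
  dotprod p (X0 *m v0) ^+ 2 <= dotprod v0 v0 * quadform (X0 *m X0^T) p.
Proof.
have -> : quadform (X0 *m X0^T) p = dotprod (X0^T *m p) (X0^T *m p).
  by rewrite /quadform -mulmxA dotprod_mulmx.
rewrite dotprod_mulmx mulrC; exact: cauchy_schwarz_sum.
Qed.

Lemma quadform_gramian n (Z : R -> 'M[R]_n) (p : 'cV[R]_n) :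
  (forall i j, mu.-integrable (`[0, +oo[ : set R) (EFin \o (fun t => Z t i j))) ->
  mu.-integrable (`[0, +oo[ : set R) (EFin \o (fun t => quadform (Z t) p)) /\
  \int[mu]_(t in `[0, +oo[) quadform (Z t) p = quadform (gramian Z) p.
Proof.
move=> ZI.
have e (M : 'M[R]_n) : quadform M p = \sum_i \sum_j (p i 0 * p j 0) * M i j.
  rewrite /quadform /dotprod; apply: eq_bigr => i _.
  by rewrite mxE mulr_sumr; apply: eq_bigr => j _; ring.
have I1 i j : mu.-integrable (`[0, +oo[ : set R) (EFin \o (fun t => (p i 0 * p j 0) * Z t i j)).
  by apply: integrable_fctZ => //; exact: ZI.
have I2 i : mu.-integrable (`[0, +oo[ : set R)
    (EFin \o (fun t => \sum_j (p i 0 * p j 0) * Z t i j)).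
  by apply: (@integrable_fct_sum _ _ R mu 'I_n _ (fun j t => (p i 0 * p j 0) * Z t i j)).
have -> : (fun t => quadform (Z t) p) = (fun t => \sum_i \sum_j (p i 0 * p j 0) * Z t i j).
  by apply/funext => t; exact: e.
split.
  by apply: (@integrable_fct_sum _ _ R mu 'I_n _ (fun i t => \sum_j (p i 0 * p j 0) * Z t i j)).
rewrite e (@Rintegral_fct_sum _ _ R mu 'I_n _ (fun i t => \sum_j (p i 0 * p j 0) * Z t i j)) //.
apply: eq_bigr => i _.
rewrite (@Rintegral_fct_sum _ _ R mu 'I_n _ (fun j t => (p i 0 * p j 0) * Z t i j)) //.
by apply: eq_bigr => j _; rewrite RintegralZl // mxE.
Qed.

Lemma energy_le_total m (w : R -> 'cV[R]_m) t :
  mu.-integrable (`[0, +oo[ : set R) (EFin \o (fun s => dotprod (w s) (w s))) ->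
  energy w t <= \int[mu]_(s in `[0, +oo[) dotprod (w s) (w s).
Proof.
move=> wI.
have sub : `[0, t] `<=` (`[0, +oo[ : set R).
  by move=> r /=; rewrite !in_itv /= andbT => /andP[].
have wI' : mu.-integrable `[0, t] (EFin \o (fun s => dotprod (w s) (w s))).
  by apply: (@integrableS _ _ _ mu) wI => //; exact: sub.
rewrite /energy /Rintegral fine_le ?integrable_fin_num //.
apply: ge0_subset_integral => //; first exact: measurable_int wI.
by move=> r _; rewrite lee_fin dotprod_ge0.
Qed.

End EnergyBounds.

(** * Domination of the state by the Gramian flow, and the output estimate *)

Lemma state_le_gramian_flow (R : realType) (n m q : nat)
    (A : 'M[R]_n) (N : 'I_m -> 'M[R]_n) (X0 : 'M[R]_(n, q)) (v0 : 'cV[R]_q)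
    (w : R -> 'cV[R]_m) (gamma : R) (x : R -> 'cV[R]_n) (Z : R -> 'M[R]_n) :
  0 < gamma ->
  (forall k, measurable_fun (`[0, +oo[ : set R) (fun s => w s k 0)) ->
  lebesgue_measure.-integrable (`[0, +oo[ : set R) (EFin \o (fun s => dotprod (w s) (w s))) ->
  caratheodory_solution (bilinear_rhs A N w) (X0 *m v0) x ->
  classical_solution (lyapunov_op A N gamma) (X0 *m X0^T) Z ->
  forall t p, 0 <= t ->
  0 <= quadform (Z t) p /\
  dotprod p (x t) ^+ 2 <= dotprod v0 v0 *
    expR (gamma ^+ 2 * \int[lebesgue_measure]_(s in `[0, +oo[) dotprod (w s) (w s)) *
    quadform (Z t) p.
Proof.
move=> g0 wm wI hx hZ t p t0.
have [K K0 KP] := lyapunov_op_le A N gamma.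
have [CZ [CZ0 Zb Zs]] := classical_solution_step hZ K0 t0 (@lyapunov_opB _ _ _ A N gamma) KP.
have [Cx Cx0 xb] := caratheodory_solution_bounded hx t0.
pose Cs := system_size A N ^+ 2 * Cx * m.+1%:R.
have Cs0 : 0 <= Cs by rewrite mulr_ge0 // mulr_ge0 // sqr_ge0.
pose C := Cx + CZ + Cs.
have C0 : 0 <= C by rewrite !addr_ge0.
have x0E : x 0 = X0 *m v0.
  have [_ ->] := hx 0 (lexx 0).
  apply/colP => i; rewrite !mxE set_itv1 Rintegral_set1 addr0.
  by [].
have Z0E : Z 0 = X0 *m X0^T by case: hZ.
have vv := dotprod_ge0 v0.
have qf0 : 0 <= quadform (X0 *m X0^T) p.
  by rewrite /quadform -mulmxA dotprod_mulmx dotprod_ge0.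
(* The comparison needs a positive E0, whereas v0 may vanish; hence any E0 above |v0|^2 is allowed
   here. *)
have cmp E0 : 0 < E0 -> dotprod v0 v0 <= E0 ->
    dotprod p (x t) ^+ 2 <= E0 * expR (gamma ^+ 2 * (energy w t - energy w 0)) * quadform (Z t) p.
  move=> E00 vE; apply: (@euler_comparison R n m A N gamma x Z (energy w) E0 C t) => //.
  - move=> y; rewrite x0E Z0E (le_trans (dotprod_gramian_factor _ _ _)) // ler_wpM2r //.
    by rewrite /quadform -mulmxA dotprod_mulmx dotprod_ge0.
  - by move=> r s r0 rs _; exact: (energy_nd wI r0 rs).
  - by move=> s i s0 st; rewrite (le_trans (xb s i s0 st)) // /C -addrA lerDl addr_ge0.
  - by move=> s i j s0 st; rewrite (le_trans (Zb s i j s0 st)) // /C addrAC lerDr addr_ge0.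
  - move=> r s i j r0 rs st; rewrite (le_trans (Zs r s i j r0 rs st)) //.
    by rewrite ler_wpM2r ?sqr_ge0 // /C addrAC lerDr addr_ge0.
  - move=> r s r0 rs st.
    exists (fun k => \int[lebesgue_measure]_(y in `]r, s]) w y k 0); split.
      exact: (control_increment_le wm wI r0 rs).
    move=> i; have xs y j : 0 <= y -> y <= s -> `|x y j 0| <= Cx.
      by move=> y0 ys; apply: xb => //; exact: le_trans st.
    have S := solution_step_le wm wI hx r0 rs xs i.
    rewrite (le_trans S) // -/Cs ler_wpM2r //.
      by rewrite addr_ge0 // subr_ge0 //; exact: (energy_nd wI r0 rs).
    by rewrite ler_wpM2r ?subr_ge0 // /C lerDr addr_ge0.
have Q0 : 0 <= quadform (Z t) p.
  have E00 : 0 < dotprod v0 v0 + 1 by rewrite ltr_wpDl.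
  have := cmp _ E00; rewrite lerDl => /(_ ler01) /(le_trans (sqr_ge0 _)).
  by rewrite pmulr_rge0 // mulr_gt0 // expR_gt0.
split => //.
set W := \int[_]_(s in _) _.
pose eQ := expR (gamma ^+ 2 * W) * quadform (Z t) p.
rewrite -mulrA -/eQ.
(* Taking E0 = |v0|^2 + 1/(k+1) and letting k grow recovers the exact factor |v0|^2. *)
apply: (@le_of_le_addn_inv _ _ _ eQ) => k.
have k0 : 0 < (k.+1%:R^-1 : R) by rewrite invr_gt0.
have := cmp (dotprod v0 v0 + k.+1%:R^-1); rewrite ltr_wpDl // lerDl (ltW k0).
move=> /(_ isT isT) /le_trans; apply.
rewrite -mulrA [eQ / _]mulrC -mulrDl ler_wpM2l ?addr_ge0 ?(ltW k0) //.
rewrite ler_wpM2r // ler_expR ler_wpM2l ?sqr_ge0 //.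
by rewrite energy0 subr0 energy_le_total.
Qed.

Theorem proposition3p1 (R : realType) (n m q : nat)
    (A : 'M[R]_n) (N : 'I_m -> 'M[R]_n) (X0 : 'M[R]_(n, q)) (v0 : 'cV[R]_q)
    (u : R -> 'cV[R]_m) (gamma : R)
    (x : R -> 'cV[R]_n) (Z : R -> 'M[R]_n)
    (p : 'I_n -> 'cV[R]_n) (lambda : 'I_n -> R)
    (hA : hurwitz A)
    (hu : in_L2 u)
    (gamma_gt0 : 0 < gamma)
    (hgamma : hurwitz (lyapunov_kron A N gamma))
    (hx : caratheodory_solution (bilinear_rhs A N u) (X0 *m v0) x)
    (hZ : classical_solution (lyapunov_op A N gamma) (X0 *m X0^T) Z)
    (hp : orthonormal_basis p)
    (hlambda : forall i, gramian Z *m p i = lambda i *: p i) :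
  forall i : 'I_n,
    (L2norm (fun t => dotprod (x t) (p i))
     <= (Num.sqrt (lambda i))%:E
        * expeR (2^-1%:E * L2norm (fun t => norm2 (gamma *: active_control N u t)) ^+ 2)
        * (norm2 v0)%:E)%E.
Proof.
move=> i.
set w := active_control N u.
have [wm wI] := active_integrable N hu.
have hx' := hx; rewrite -active_bilinear_rhs in hx'.
have [K [c [c0 Zd]]] := classical_solution_decay hgamma hZ.
have ZI k l : lebesgue_measure.-integrable (`[0, +oo[ : set R) (EFin \o (fun t => Z t k l)).
  apply: (integrable_of_decay c0 _ (fun t => Zd t k l)).
  by apply: within_continuous_entry; case: hZ.
have [QI QE] := quadform_gramian (p i) ZI.
(* As p_i is a unit eigenvector, the Gramian form at p_i, which is the time integral of the forms of
   Z, equals the eigenvalue. *)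
have lam : quadform (gramian Z) (p i) = lambda i.
  by rewrite /quadform hlambda dotprodZr hp eqxx mulr1.
rewrite lam in QE.
have main t := state_le_gramian_flow gamma_gt0 wm wI hx' hZ (t := t) (p i).
set W := \int[_]_(s in _) _ in main.
have W0 : 0 <= W by apply: Rintegral_ge0 => s _; exact: dotprod_ge0.
have lam0 : 0 <= lambda i.
  rewrite -QE; apply: Rintegral_ge0 => t /=; rewrite in_itv /= andbT => t0.
  by have [] := main t t0.
have WE : (\int[lebesgue_measure]_(s in `[0%R, +oo[) (dotprod (w s) (w s))%:E = W%:E)%E.
  by rewrite /W /Rintegral fineK //; apply: integrable_fin_num => //; exact: wI.
have L2w : L2norm (fun t => norm2 (gamma *: w t)) = (gamma * Num.sqrt W)%:E.
  rewrite /L2norm.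
  under eq_integral => t _.
    rewrite sqr_norm2 dotprodZr dotprodC dotprodZr mulrA -expr2 EFinM; over.
  rewrite (integralZl _ wI) // [X in (_ * X)%E]WE.
  rewrite -EFinM poweR_EFin powR12_sqrt; last exact: mulr_ge0 (sqr_ge0 gamma) W0.
  by rewrite sqrtrM ?sqr_ge0 // sqrtr_sqr gtr0_norm.
rewrite L2w -EFin_expe.
rewrite -[leRHS]/((Num.sqrt (lambda i) * expR (2^-1 * (gamma * Num.sqrt W) ^+ 2) * norm2 v0)%:E).
set B := dotprod v0 v0 * expR (gamma ^+ 2 * W) in main.
have B0 : 0 <= B by rewrite mulr_ge0 ?dotprod_ge0 ?expR_ge0.
(* The factor 1/2 in the exponent arises from the square root of the exponential in [B]. Both sides
   become powers 1/2, and the claim reduces to comparing the integrals under them. *)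
have rhsE : Num.sqrt (lambda i) * expR (2^-1 * (gamma * Num.sqrt W) ^+ 2) * norm2 v0 =
    (B * lambda i) `^ 2^-1.
  rewrite powR12_sqrt; last exact: mulr_ge0 B0 lam0.
  rewrite sqrtrM // /B sqrtrM ?dotprod_ge0 // -/(norm2 v0).
  have -> : Num.sqrt (expR (gamma ^+ 2 * W)) = expR (2^-1 * (gamma ^+ 2 * W)).
    by rewrite -powR12_sqrt ?expR_ge0 // -expRM mulrC.
  by rewrite exprMn sqr_sqrtr //; ring.
rewrite rhsE -poweR_EFin /L2norm gt0_ler_poweR //.
- rewrite in_itv /= leey andbT.
  by apply: integral_ge0 => t _; rewrite lee_fin sqr_ge0.
- by rewrite in_itv /= leey andbT lee_fin mulr_ge0.
have BI : lebesgue_measure.-integrable (`[0, +oo[ : set R)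
    (EFin \o (fun t => B * quadform (Z t) (p i))) by exact: integrable_fctZ.
have -> : (B * lambda i)%:E =
    (\int[lebesgue_measure]_(t in `[0%R, +oo[) (B * quadform (Z t) (p i))%:E)%E.
  by rewrite -QE -RintegralZl // fineK //; apply: integrable_fin_num => //; exact: BI.
apply: ge0_le_integral => //.
- by move=> t _; rewrite lee_fin sqr_ge0.
- apply/measurable_EFinP; apply: measurable_funX.
  apply: measurable_sum => k.
  by apply: measurable_funM; [exact: (caratheodory_solution_measurable hx' k)|exact: measurable_cst].
- exact: measurable_int BI.
- move=> t /=; rewrite in_itv /= andbT => t0; rewrite lee_fin dotprodC.
  by case: (main t t0).
Qed.
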